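(* Let $\mathcal H$ be a Hilbert space of at most countable dimension, $D$ an index set for its orthonormal bases, and $\mathcal B=\mathcal B(\mathcal H)$. Let $P_H$ be the quantum Markov chain on $\mathcal A_H=\bigotimes_{\mathbb N}\mathcal B$ determined by $(\varphi_0,\mathcal E)$ with $$\varphi_0=\mathrm{Tr}(w_0\,\cdot\,),\quad w_0=\sum_{j\in D}p^{(0)}_{H;j}e_{H;jj}\ \text{ a density operator with non-degenerate spectrum},$$ $$\mathcal E(x)=\overline{\mathrm{Tr}}_2(K_H^*xK_H),\quad K_H=\sum_{i,j\in D}\sqrt{p_{H;ij}}\;e_{H;ii}\otimes e_{H;jj},$$ where $(e_{H;j})_{j\in D}$ is an orthonormal basis of $\mathcal H$ and $(p_{H;ij})$ is a stochastic matrix. For each $n\in\mathbb N$ let $(e_{H'_n;j})_{j\in D}$ and $(e_{O'_n;j})_{j\in D}$ be orthonormal bases of $\mathcal H$ and let $$K_{O',H',n}=\sum_{i,j\in D}K_{O',H',n;i,j}\;e_{H'_n;ii}\otimes e_{O'_n;jj}\qquad(K_{O',H',n;i,j}\in\mathbb C)$$ be a conditional density amplitude, i.e. $\overline{\mathrm{Tr}}_2(K_{O',H',n}^*K_{O',H',n})=1$. Consider the quantum hidden Markov $(H,O)$-process with hidden process $P_H$ and emission operators $$\mathcal E_{O,H,n}(x)=\overline{\mathrm{Tr}}_2(K_{O',H',n}^*\,x\,K_{O',H',n}),\qquad x\in\mathcal B_{H_n}\otimes\mathcal B_{O_n}\equiv\mathcal B\otimes\mathcal B .$$ Then the joint probabilities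 of this process restricted to the diagonal algebra $\mathcal D_{H'}\otimes\mathcal D_{O'}$ are given, for all $n\in\mathbb N$ and $h_0,\dots,h_n,k_0,\dots,k_n\in D$, by $$P_{H,O}\Bigl(\prod_{m=0}^nj_{H_m}(e_{H'_m;h_mh_m})\prod_{m=0}^nj_{O_m}(e_{O'_m;k_mk_m})\Bigr)=\Bigl(\prod_{m=0}^np_{O,H',m;h_m,k_m}\Bigr)\sum_{j_0,\dots,j_n\in D}p^{(0)}_{H;j_0}p_{H;j_0j_1}\cdots p_{H;j_{n-1}j_n}\prod_{m=0}^n|\langle e_{H;j_m},e_{H'_m;h_m}\rangle|^2,$$ where $p_{O,H',m;i,j}=|K_{O',H',m;i,j}|^2$.
   Context: For an orthonormal basis $(e_j)$, $e_{jj}$ is the rank-one projection onto $\mathbb Ce_j$. $\overline{\mathrm{Tr}}_2(a\otimes b)=a\,\mathrm{Tr}(b)$ is the partial trace. $\sqrt{p}$ denotes an arbitrary square root of $p$. If $D$ is infinite, sums of operators converge strongly and $K_H$, $K_{O',H',n}$ are bounded operators on $\mathcal H\otimes\mathcal H$. Tensor products of algebras are algebraic. The state of the quantum Markov chain determined by $(\varphi_0,\mathcal E)$ is given by $$P_H(j_{H_0}(a_0)\cdots j_{H_n}(a_n))=\varphi_0(\mathcal E(a_0\otimes\mathcal E(a_1\otimes\cdots\otimes\mathcal E(a_{n-1}\otimes\mathcal E(a_n\otimes1))\cdots))).$$ Here $\mathcal B_{H_n}\equiv\mathcal B_{O_n}\equiv\mathcal B$, $\mathcal A_{H,O}=\bigotimes_n(\mathcal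 B_{H_n}\otimes\mathcal B_{O_n})$, and $j_{H_n},j_{O_n}$ are the tensor embeddings. The quantum hidden Markov process with hidden process $P_H$ and emission operators $\mathcal E_{O,H,n}:\mathcal B_{H_n}\otimes\mathcal B_{O_n}\to\mathcal B_{H_n}$ has state $P_{H,O}=P_H\circ\bigotimes_n\mathcal E_{O,H,n}$, i.e. $$P_{H,O}\Bigl(\prod_{m=0}^nj_{H_m}(g_m)j_{O_m}(f_m)\Bigr)=P_H\Bigl(\prod_{m=0}^nj_{H_m}(\mathcal E_{O,H,m}(g_m\otimes f_m))\Bigr).$$ $\mathcal D_{H'}$ (resp. $\mathcal D_{O'}$) is the algebra generated by all $j_{H_n}(e_{H'_n;jj})$ (resp. $j_{O_n}(e_{O'_n;jj})$), $n\in\mathbb N$, $j\in D$. *)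

(* Defs.v *)
From HB Require Import structures.
From mathcomp Require Import all_boot all_order all_algebra.
From mathcomp Require Import finmap sesquilinear complex.
From mathcomp Require Import boolp classical_sets functions filter reals topology.
From mathcomp Require Import normedtype.
From mathcomp.analysis.showcase Require Import summability.
Set Implicit Arguments.
Unset Strict Implicit.
Unset Printing Implicit Defensive.
Import Order.TTheory GRing.Theory Num.Theory.
Import numFieldNormedType.Exports.
Local Open Scope classical_set_scope.
Local Open Scope ring_scope.
Local Open Scope complex_scope.

(* Unordered summation: convergence of the net of finite partial sums. *)
Definition has_sum {I : choiceType} {K : numFieldType} {V : normedModType K}
    (x : I -> V) (l : V) : Prop :=
  partial_sum x @ totally --> l.

(* The inner product is linear in its first argument, the convention of
   [sesquilinear]. *)
HB.mixin Record isHilbert (R : realType) V & CompleteNormedModule R[i] V := {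
  inner : {dot V for (@Num.conj R[i])} ;
  sqr_norm_inner : forall u : V, `|u| ^+ 2 = inner u u
}.

#[short(type="hilbertType")]
HB.structure Definition Hilbert (R : realType) :=
  {V of isHilbert R V & CompleteNormedModule R[i] V}.

Section Bounded.
Context {R : realType} {V : hilbertType R}.
Local Notation C := R[i].

Definition bounded_op : {pred V -> V} :=
  fun f => `[< linear f /\ exists2 M : C, 0 <= M & forall v, `|f v| <= M * `|v| >].

Fact bounded_op_submod : submod_closed bounded_op.
Proof.
split=> [|c f g /asboolP[lf [M M0 fM]] /asboolP[lg [N N0 gN]]];
  apply/asboolP; split.
- by move=> a u v; rewrite /= scaler0 addr0.
- by exists 0 => // v; rewrite normr0 mul0r.
- move=> a u v; rewrite !fctE lf lg !scalerDr !scalerA (mulrC c a) addrACA.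
  by rewrite -!scalerA.
- exists (`|c| * M + N) => [|v]; first by rewrite addr_ge0// mulr_ge0.
  rewrite !fctE (le_trans (ler_normD _ _))//.
  by rewrite normrZ mulrDl -mulrA lerD// ler_wpM2l.
Qed.

HB.instance Definition _ :=
  GRing.isSubmodClosed.Build C (V -> V) bounded_op bounded_op_submod.

End Bounded.

Record bop (R : realType) (V : hilbertType R) :=
  Bop { bop_fun :> V -> V ; bop_funP : bop_fun \in bounded_op }.

HB.instance Definition _ (R : realType) (V : hilbertType R) :=
  [isSub for @bop_fun R V].
HB.instance Definition _ (R : realType) (V : hilbertType R) :=
  [Choice of bop V by <:].
HB.instance Definition _ (R : realType) (V : hilbertType R) :=
  [SubChoice_isSubLmodule of bop V by <:].

Section BoundedRing.
Context {R : realType} {V : hilbertType R}.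
Implicit Types f g h : bop V.

Fact bop_one_subproof : (id : V -> V) \in bounded_op.
Proof. by apply/asboolP; split=> //; exists 1 => // v; rewrite mul1r. Qed.

Fact bop_comp_subproof f g : (f \o g : V -> V) \in bounded_op.
Proof.
have /asboolP[lf [M M0 fM]] := bop_funP f.
have /asboolP[lg [N N0 gN]] := bop_funP g.
apply/asboolP; split=> [a u v|]; first by rewrite /= lg lf.
exists (M * N) => [|v /=]; first exact: mulr_ge0.
by rewrite (le_trans (fM _))// -mulrA ler_wpM2l.
Qed.

Definition bop_one : bop V := Bop bop_one_subproof.
Definition bop_comp f g : bop V := Bop (bop_comp_subproof f g).

Fact bop_compA : associative bop_comp.
Proof. by move=> f g h; apply: val_inj. Qed.
Fact bop_comp1f : left_id bop_one bop_comp.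
Proof. by move=> f; apply: val_inj. Qed.
Fact bop_compf1 : right_id bop_one bop_comp.
Proof. by move=> f; apply: val_inj. Qed.
Fact bop_compDl : left_distributive bop_comp +%R.
Proof. by move=> f g h; apply: val_inj. Qed.
Fact bop_compDr : right_distributive bop_comp +%R.
Proof.
move=> f g h; apply: val_inj; apply/funext => v /=.
have /asboolP[lf _] := bop_funP f.
by have := lf 1 (g v) (h v); rewrite !scale1r.
Qed.

(* Possibly the zero ring, since V = 0 is allowed. *)
HB.instance Definition _ := GRing.Zmodule_isPzRing.Build (bop V)
  bop_compA bop_comp1f bop_compf1 bop_compDl bop_compDr.

End BoundedRing.

Section HilbertNotions.
Context {R : realType} {V : hilbertType R}.
Local Notation C := R[i].

Definition lspan (S : set V) : set V :=
  [set v | exists2 s : seq (C * V),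
    (forall x, x \in s -> S x.2) & v = \sum_(x <- s) x.1 *: x.2].

Definition orthonormal_basis {I : choiceType} (e : I -> V) : Prop :=
  (forall i j, inner (e i) (e j) = (i == j)%:R) /\
  closure (lspan (range e)) = setT.

Lemma inner_le (u v : V) : `|inner u v| <= `|u| * `|v|.
Proof.
have [->|v0] := eqVneq v 0; first by rewrite linear0r !normr0 mulr0.
have v_gt0 : 0 < `|v| by rewrite normr_gt0.
pose t := inner u v; pose w := `|v| ^+ 2 *: u - t *: v.
have : 0 <= inner w w by exact: dnorm_ge0.
rewrite /w dnormB !dnormZ -!sqr_norm_inner linearZl_LR linearZr_LR /= -/t.
rewrite normrX normr_id (mulrC _ t) -normCK.
rewrite (@conj_Creal _ (_ * _)) ?ger0_real ?mulr_ge0 ?exprn_ge0//.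
rewrite (mulrC (_ ^+ 2) (`|v| ^+ 2)) opprD addrA addrK -mulrA -mulrBr.
rewrite pmulr_rge0 ?exprn_gt0// subr_ge0 => tuv.
by rewrite -(@ler_pXn2r _ 2) ?nnegrE ?mulr_ge0// exprMn mulrC.
Qed.

(* The rank-one operator |x><x|: the projection onto C x when |x| = 1. *)
Fact rank1_subproof (x : V) : (fun v => inner v x *: x) \in bounded_op.
Proof.
apply/asboolP; split=> [a u v|].
  by rewrite linearPl /= scalerDl scalerA.
exists (`|x| * `|x|) => [|v]; first exact: mulr_ge0.
by rewrite normrZ mulrC -mulrA ler_wpM2l// mulrC inner_le.
Qed.
Definition rank1 (x : V) : bop V := Bop (rank1_subproof x).

Definition strong_sum {I : choiceType} (F : I -> bop V) (a : bop V) : Prop :=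
  forall v, has_sum (fun i => F i v) (a v).

Definition is_adjoint (a b : bop V) : Prop :=
  forall u v, inner (a u) v = inner u (b v).

Definition adjoint (a : bop V) : bop V := xget 0 (is_adjoint a).

(* Since [inner] is linear on the left, [inner (a e) e] is <e, a e>. *)
Definition is_trace (a : bop V) (t : C) : Prop :=
  forall (I : choiceType) (e : I -> V), orthonormal_basis e ->
    has_sum (fun i => inner (a (e i)) (e i) : C^o) t.

Definition trace (a : bop V) : C := xget 0 (is_trace a).

Definition density_operator (w : bop V) : Prop :=
  (forall v, 0 <= inner (w v) v) /\ is_trace w 1.

(* Every eigenvalue has a one-dimensional eigenspace. *)
Definition nondegenerate_spectrum (w : bop V) : Prop :=
  forall (l : C) (u v : V), u != 0 -> w u = l *: u -> w v = l *: v ->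
    exists c : C, v = c *: u.

End HilbertNotions.

(* [K] with the bilinear map [tens] is a realisation of the Hilbert space
   tensor product of [H1] and [H2]; it is determined up to a unique unitary. *)
Record htensor (R : realType) (H1 H2 K : hilbertType R) := HTensor {
  tens :> {bilinear H1 -> H2 -> K} ;
  inner_tens : forall u u' v v',
    inner (tens u v) (tens u' v') = inner u u' * inner v v' ;
  tens_total : closure (lspan [set x | exists u v, x = tens u v]) = setT
}.

Section TensorOperators.
Context {R : realType} {H1 H2 K : hilbertType R} (T : htensor H1 H2 K).
Local Notation C := R[i].

Definition optens (a : bop H1) (b : bop H2) : bop K :=
  xget 0 [set x : bop K | forall u v, x (T u v) = T (a u) (b v)].

(* The partial trace over the second factor, which sends a (x) b to Tr(b) a:
   <v, t u> = sum_i <v (x) e_i, x (u (x) e_i)> in every orthonormal basis. *)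
Definition is_ptrace2 (x : bop K) (t : bop H1) : Prop :=
  forall (I : choiceType) (e : I -> H2), orthonormal_basis e ->
    forall u v,
      has_sum (fun i => inner (x (T u (e i))) (T v (e i)) : C^o) (inner (t u) v).

Definition ptrace2 (x : bop K) : bop H1 := xget 0 (is_ptrace2 x).

(* x |-> Tr_2(k^* x k) *)
Definition transition (k x : bop K) : bop H1 :=
  ptrace2 (adjoint k * x * k).

Definition conditional_density_amplitude (k : bop K) : Prop :=
  ptrace2 (adjoint k * k) = 1.

End TensorOperators.

Definition stochastic {R : realType} {D : choiceType} (p : D -> D -> R) : Prop :=
  (forall i j, 0 <= p i j) /\ forall i, has_sum (p i : D -> R^o) 1.

Section Processes.
Context {R : realType} {H K : hilbertType R} (T : htensor H H K).
Local Notation C := R[i].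
Local Notation B := (bop H).

Definition commuting_homs {I : Type} {A : algType C} (j : I -> B -> A) :
    Prop :=
  (forall i, linear (j i) /\ monoid_morphism (j i)) /\
  (forall i k a b, i <> k -> j i a * j k b = j k b * j i a).

(* [A] with the embeddings [j] is the algebraic tensor product, over the
   possibly infinite index set [I], of copies of the unital algebra B(H): it is
   universal among unital algebras receiving commuting copies of B(H). *)
Definition algebraic_tensor_product {I : Type} {A : algType C}
    (j : I -> B -> A) : Prop :=
  commuting_homs j /\
  forall (A' : algType C) (g : I -> B -> A'), commuting_homs g ->
    exists phi : {lrmorphism A -> A'},
      (forall i a, phi (j i a) = g i a) /\
      forall psi : {lrmorphism A -> A'},
        (forall i a, psi (j i a) = g i a) -> psi =1 phi.

(* E(a_0 (x) E(a_1 (x) ... E(a_n (x) 1))) *)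
Fixpoint nested (E : bop K -> B) (s : seq B) : B :=
  if s is a :: s' then E (optens T a (nested E s')) else 1.

Definition quantum_markov_chain {A : algType C} (jH : nat -> B -> A)
    (phi0 : B -> C) (E : bop K -> B) (P : {scalar A}) : Prop :=
  forall (n : nat) (a : nat -> B),
    P (\prod_(m < n.+1) jH m (a m)) = phi0 (nested E (mkseq a n.+1)).

Definition quantum_hidden_process {A AO : algType C} (jH : nat -> B -> A)
    (P : {scalar A}) (iH iO : nat -> B -> AO) (EO : nat -> bop K -> B)
    (PO : {scalar AO}) : Prop :=
  forall (n : nat) (g f : nat -> B),
    PO (\prod_(m < n.+1) (iH m (g m) * iO m (f m))) =
    P (\prod_(m < n.+1) jH m (EO m (optens T (g m) (f m)))).

End Processes.

(* Main.v *)
(* Every iterate E(a_m (x) E(a_(m+1) (x) ...)) of the chain is a positive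
   operator b = sum_j |z_j><z_j|. On such operators the transition is explicit:
   if <u, y_j> denotes <K_H (u (x) e_j), x (x) e_j>, then
     Tr_2(K_H^* (|x><x| (x) b) K_H) = sum_j <b e_j, e_j> |y_j><y_j|,
   and the diagonal entries of the result obey the backward recursion
     beta'_i = |<e_i, x>|^2 sum_j p_ij beta_j.
   All traces are compared on the diagonal of a sesquilinear form, where the
   double sums have nonnegative terms and Tonelli applies, and are transferred
   to arbitrary arguments by polarization. The emission operators send
   |h><h| (x) |k><k| to |K_hk|^2 |h><h|, because K_{O',H'} is diagonal in the
   product basis. *)

Require Import Defs.
From HB Require Import structures.
From mathcomp Require Import all_boot all_order all_algebra.
From mathcomp Require Import finmap sesquilinear complex.
From mathcomp Require Import boolp classical_sets functions filter reals topology.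
From mathcomp Require Import normedtype.
From mathcomp Require Import ring.
From mathcomp.analysis.showcase Require Import summability.
Set Implicit Arguments.
Unset Strict Implicit.
Unset Printing Implicit Defensive.
Import Order.TTheory GRing.Theory Num.Theory.
Import numFieldNormedType.Exports.
Local Open Scope classical_set_scope.
Local Open Scope ring_scope.
Local Open Scope complex_scope.

#[local] Existing Instance totally_filter.

(** * Unordered sums *)

Lemma partial_sumE {I : choiceType} {V : zmodType} (x : I -> V) (A : {fset I}) :
  partial_sum x A = \sum_(i <- A) x i.
Proof. by rewrite big_seq_fsetE. Qed.

Lemma has_sumP {I : choiceType} {K : numFieldType} {V : normedModType K}
    (x : I -> V) (l : V) :
  has_sum x l <-> forall e : K, 0 < e -> exists A : {fset I},
    forall B : {fset I}, (A `<=` B)%fset -> `|l - \sum_(i <- B) x i| < e.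
Proof.
rewrite /has_sum; split=> [/cvgrPdist_lt xl e /xl [A _ AB]|xl].
  by exists A => B /AB; rewrite partial_sumE.
apply/cvgrPdist_lt => e /xl [A AB]; exists A => // B /AB.
by rewrite partial_sumE.
Qed.

Lemma has_sum_unique {I : choiceType} {K : numFieldType} {V : normedModType K}
    (x : I -> V) (l l' : V) : has_sum x l -> has_sum x l' -> l = l'.
Proof. exact: norm_cvg_unique. Qed.

Lemma eq_has_sum {I : choiceType} {K : numFieldType} {V : normedModType K}
    (x y : I -> V) (l l' : V) : x =1 y -> l = l' -> has_sum x l -> has_sum y l'.
Proof. by move=> /funext -> ->. Qed.

(** Only additivity and a norm bound are asked of [f], so the lemma also serves the conjugate-linear
    maps [inner v]. *)
Lemma has_sum_map {I : choiceType} {K : numFieldType} {V W : normedModType K}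
    (f : V -> W) (M : K) (x : I -> V) (l : V) :
  {morph f : u v / u - v} -> 0 <= M -> (forall v, `|f v| <= M * `|v|) ->
  has_sum x l -> has_sum (f \o x) (f l).
Proof.
move=> fB M0 fM /has_sumP xl; apply/has_sumP => e e0.
have M1 : 0 < M + 1 by rewrite ltr_wpDl.
have f0 : f 0 = 0 by rewrite -[X in f X](subrr 0) fB subrr.
have fD u v : f (u + v) = f u + f v.
  by rewrite -{1}[v]opprK fB -[- v]sub0r fB f0 sub0r opprK.
(* Dividing by [M + 1] covers the case [M = 0]. *)
have [|A AB] := xl (e / (M + 1)); first by rewrite divr_gt0.
exists A => B /AB; rewrite ltr_pdivlMr// mulrC.
rewrite -(big_morph f fD f0) -fB; apply: le_lt_trans.
by rewrite (le_trans (fM _))// ler_wpM2r// lerDl.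
Qed.

Lemma has_sumD {I : choiceType} {K : numFieldType} {V : normedModType K}
    (x y : I -> V) (l l' : V) :
  has_sum x l -> has_sum y l' -> has_sum (fun i => x i + y i) (l + l').
Proof.
move=> xl yl; rewrite /has_sum.
have -> : partial_sum (fun i => x i + y i) = partial_sum x + partial_sum y.
  by apply/funext => A; rewrite /partial_sum big_split.
exact: cvgD.
Qed.

Lemma has_sumZ {I : choiceType} {K : numFieldType} {V : normedModType K}
    (c : K) (x : I -> V) (l : V) :
  has_sum x l -> has_sum (fun i => c *: x i) (c *: l).
Proof.
apply: (@has_sum_map _ _ _ _ _ `|c|) => // [u v|v]; first exact: scalerBr.
by rewrite normrZ.
Qed.

Arguments has_sumZ {I K V} c {x l}.

Lemma has_sumB {I : choiceType} {K : numFieldType} {V : normedModType K}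
    (x y : I -> V) (l l' : V) :
  has_sum x l -> has_sum y l' -> has_sum (fun i => x i - y i) (l - l').
Proof.
move=> xl /(has_sumZ (-1)) yl; have := has_sumD xl yl.
by apply: eq_has_sum => [i|]; rewrite scaleN1r.
Qed.

Lemma has_sum0 {I : choiceType} {K : numFieldType} {V : normedModType K} :
  has_sum (fun _ : I => 0 : V) 0.
Proof.
apply/has_sumP => e e0; exists fset0 => B _.
by rewrite big1// subr0 normr0.
Qed.

Lemma has_sum_big {I : choiceType} {J : Type} {K : numFieldType}
    {V : normedModType K} (s : seq J) (x : J -> I -> V) (l : J -> V) :
  (forall j, has_sum (x j) (l j)) ->
  has_sum (fun i => \sum_(j <- s) x j i) (\sum_(j <- s) l j).
Proof.
move=> xl; elim: s => [|j s IHs].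
  by apply: eq_has_sum has_sum0 => [i|]; rewrite big_nil.
by apply: eq_has_sum (has_sumD (xl j) IHs) => [i|]; rewrite big_cons.
Qed.

Lemma has_sum_single {I : choiceType} {K : numFieldType} {V : normedModType K}
    (x : I -> V) (i0 : I) : (forall i, i != i0 -> x i = 0) -> has_sum x (x i0).
Proof.
move=> x0; apply/has_sumP => e e0; exists [fset i0]%fset => B.
rewrite fsub1set => i0B.
rewrite (big_fsetD1 i0)//= big_seq big1 ?addr0 ?subrr ?normr0// => i.
by rewrite !inE => /andP[/x0].
Qed.

(** A finite set [B] containing the image of [A] has the same sum as its preimage under [f], because
    [x] vanishes off the range of [f]; this preimage contains [A]. *)
Lemma has_sum_reindex {I J : choiceType} {K : numFieldType}
    {V : normedModType K} (f : I -> J) (g : J -> option I) (x : J -> V) (l : V) :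
  pcancel f g -> ocancel g f -> (forall j, g j = None -> x j = 0) ->
  has_sum (x \o f) l -> has_sum x l.
Proof.
move=> fK gK x0 /has_sumP xl; apply/has_sumP => e /xl[A AB].
exists (f @` A)%fset => B fAB.
have sumE : \sum_(j <- B) x j = \sum_(i <- pmap g B) x (f i).
  elim: (enum_fset B) => [|j s IHs]; first by rewrite !big_nil.
  rewrite big_cons IHs /=; case E: (g j) => [i|] /=.
    by rewrite big_cons; have := gK j; rewrite E /= => ->.
  by rewrite x0// add0r.
pose C := [fset i | i in pmap g B]%fset.
have -> : \sum_(j <- B) x j = \sum_(i <- C) (x \o f) i.
  rewrite sumE; apply: perm_big; apply: uniq_perm => [||i].
  - exact/(pmap_uniq gK)/fset_uniq.
  - exact: fset_uniq.
  - by rewrite !inE.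
apply: AB; apply/fsubsetP => i iA; rewrite !inE /=.
rewrite mem_pmap; apply/mapP; exists (f i); last by rewrite fK.
by apply: (fsubsetP fAB); apply: in_imfset.
Qed.

(** * Nonnegative families and Tonelli's theorem *)

Lemma approx_ge0 (K : numFieldType) (d : K) :
  (forall e : K, 0 < e -> exists2 y : K, 0 <= y & `|d - y| < e) -> 0 <= d.
Proof.
(* The order on complex scalars is partial, so [d] is shown to equal its own absolute value. *)
move=> dP; suff -> : d = `|d| by [].
apply/eqP; rewrite -subr_eq0 -normr_le0; apply/ler_addgt0Pr => e e0.
have [|y y0 dy] := dP (e / 2); first by rewrite divr_gt0.
rewrite add0r (splitr e) -(subrKA y) (le_trans (ler_normD _ _))// ltW// ltrD//.

apply: le_lt_trans dy; rewrite distrC -[X in _ - X](ger0_norm y0).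
exact: ler_dist_dist.
Qed.

Lemma has_sum_ge0 {I : choiceType} {K : numFieldType} (x : I -> K^o) (l : K) :
  (forall i, 0 <= x i) -> has_sum x l -> 0 <= l.
Proof.
move=> x0 /has_sumP xl; apply: approx_ge0 => e /xl[A /(_ A)].
by rewrite fsubset_refl => /(_ isT); exists (\sum_(i <- A) x i); rewrite ?sumr_ge0.
Qed.

Lemma has_sum_le {I : choiceType} {K : numFieldType} (x y : I -> K^o) (l l' : K) :
  (forall i, x i <= y i) -> has_sum x l -> has_sum y l' -> l <= l'.
Proof.
move=> xy xl yl; rewrite -subr_ge0.
by apply: has_sum_ge0 (has_sumB yl xl) => i; rewrite subr_ge0.
Qed.

Lemma big_fsetS {I : choiceType} {V : nmodType} (x : I -> V) (A B : {fset I}) :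
  (A `<=` B)%fset ->
  \sum_(i <- B) x i = \sum_(i <- A) x i + \sum_(i <- (B `\` A)%fset) x i.
Proof.
move=> AB; rewrite (big_fsetID _ (mem A))/=.
congr (_ + _); apply: perm_big; apply: uniq_perm; rewrite ?fset_uniq// => i.
  by rewrite !inE /=; case: (boolP (i \in A)) => [/(fsubsetP AB)->|]; rewrite ?andbF.
by rewrite !inE /= andbC.
Qed.

Lemma ler_sum_fset {I : choiceType} {K : numDomainType} (x : I -> K)
    (A B : {fset I}) : (forall i, 0 <= x i) -> (A `<=` B)%fset ->
  \sum_(i <- A) x i <= \sum_(i <- B) x i.
Proof. by move=> x0 /(big_fsetS x) ->; rewrite lerDl sumr_ge0. Qed.

Lemma has_sum_sup {I : choiceType} {K : numFieldType} (x : I -> K^o) (l : K)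
    (A : {fset I}) :
  (forall i, 0 <= x i) -> has_sum x l -> \sum_(i <- A) x i <= l.
Proof.
move=> x0 /has_sumP xl; rewrite -subr_ge0; apply: approx_ge0 => e /xl[B BP].
exists (\sum_(i <- (A `|` B)%fset) x i - \sum_(i <- A) x i).
  by rewrite subr_ge0 ler_sum_fset ?fsubsetUl.
by rewrite opprB addrA subrK; apply: BP; exact: fsubsetUr.
Qed.

Lemma norm_has_sum_le {I : choiceType} {K : numFieldType} {V : normedModType K}
    (x : I -> V) (l : V) (M : K) :
  (forall A : {fset I}, `|\sum_(i <- A) x i| <= M) -> has_sum x l -> `|l| <= M.
Proof.
move=> xM /has_sumP xl; rewrite -subr_ge0; apply: approx_ge0 => e /xl[A /(_ A)].
rewrite fsubset_refl => /(_ isT) lA.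
exists (M - `|\sum_(i <- A) x i|); first by rewrite subr_ge0.
rewrite opprB addrC addrA subrK distrC.
by rewrite (le_lt_trans (ler_dist_dist _ _)).
Qed.

Lemma has_sum_le_bound {I : choiceType} {K : numFieldType} (x : I -> K^o)
    (l M : K) : (forall i, 0 <= x i) ->
  (forall A : {fset I}, \sum_(i <- A) x i <= M) -> has_sum x l -> l <= M.
Proof.
move=> x0 xM xl; have l0 := has_sum_ge0 x0 xl; rewrite -(ger0_norm l0).
by apply: (norm_has_sum_le _ xl) => A; rewrite ger0_norm ?sumr_ge0.
Qed.

(** Nonnegative complex partial sums are real, so the sum is found as a supremum in [R]. *)
Lemma has_sum_bounded {R : realType} {I : choiceType} (x : I -> R[i]^o) (M : R[i]) :
  (forall i, 0 <= x i) -> (forall A : {fset I}, \sum_(i <- A) x i <= M) ->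
  exists l : R[i], has_sum x l.
Proof.
move=> x0 xM; pose s (A : {fset I}) := complex.Re (\sum_(i <- A) x i).
have sE (A : {fset I}) : \sum_(i <- A) x i = (s A)%:C.
  by rewrite RRe_real// ger0_real// sumr_ge0.
have sub : has_ubound (range s).
  by exists (complex.Re M) => _ [A _ <-]; have := xM A; rewrite lecE => /andP[].
have sne : range s !=set0 by exists (s fset0), fset0.
exists (sup (range s))%:C; apply/has_sumP => e e0.
have eE : e = (complex.Re e)%:C by rewrite RRe_real// ger0_real// ltW.
have e0' : 0 < complex.Re e by rewrite -ltcR -eE.
have [_ [A _ <-] lA] := sup_adherent e0' (conj sne sub).
exists A => B AB; rewrite sE -rmorphB /=.
have sAB : s A <= s B by rewrite -lecR -!sE ler_sum_fset.
have sB : s B <= sup (range s) by apply: ub_le_sup => //; exists B.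
rewrite ger0_norm ?ler0c ?subr_ge0// eE ltcR.
by rewrite ltrBlDr -ltrBlDl (lt_le_trans lA).
Qed.

(** Adding finitely many rows gives a family in [j] dominated termwise by [c], so the partial sums
    of [r] are bounded by [s]. *)
Lemma tonelli_le {R : realType} {I J : choiceType} (F : I -> J -> R[i]^o)
    (r : I -> R[i]^o) (c : J -> R[i]^o) (s : R[i]) :
  (forall i j, 0 <= F i j) -> (forall i, has_sum (F i) (r i)) ->
  (forall j, has_sum (F^~ j) (c j)) -> has_sum c s ->
  exists2 t : R[i], has_sum r t & t <= s.
Proof.
move=> F0 Fr Fc cs; have r0 i : 0 <= r i by exact: has_sum_ge0 (Fr i).
have rs (A : {fset I}) : \sum_(i <- A) r i <= s.
  have FA := has_sum_big (s := A) Fr.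
  apply: (has_sum_le _ FA cs) => j.
  by apply: has_sum_sup (Fc j) => i; exact: F0.
have [t rt] := has_sum_bounded r0 rs; exists t => //.
exact: (has_sum_le_bound r0 rs rt).
Qed.

(** The one-sided bound is applied a second time with rows and columns exchanged. *)
Lemma tonelli {R : realType} {I J : choiceType} (F : I -> J -> R[i]^o)
    (r : I -> R[i]^o) (c : J -> R[i]^o) (s : R[i]) :
  (forall i j, 0 <= F i j) -> (forall i, has_sum (F i) (r i)) ->
  (forall j, has_sum (F^~ j) (c j)) -> has_sum c s -> has_sum r s.
Proof.
move=> F0 Fr Fc cs; have [t rt ts] := tonelli_le F0 Fr Fc cs.
have [s' cs' s't] := tonelli_le (fun j i => F0 i j) Fc Fr rt.
suff -> : s = t by [].
by apply/eqP; rewrite eq_le ts -(has_sum_unique cs' cs) s't.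
Qed.

(** Tonelli is applied to a family indexed by a pair and a first coordinate that vanishes unless the
    two agree: each row has at most one nonzero entry, and column [i] is the fibre over [i]. *)
Lemma tonelli_pair {R : realType} {I J : choiceType} (F : I * J -> R[i]^o)
    (r : I -> R[i]^o) (s : R[i]) :
  (forall q, 0 <= F q) -> (forall i, has_sum (fun j => F (i, j) : R[i]^o) (r i)) ->
  has_sum r s -> has_sum F s.
Proof.
move=> F0 Fr rs.
pose G (q : I * J) (i : I) : R[i]^o := if i == q.1 then F q else 0.
apply: (@tonelli _ _ _ G F r) rs => [q i|q|i].
- by rewrite /G; case: ifP.
- have -> : F q = G q q.1 by rewrite /G eqxx.
  by apply: has_sum_single => i; rewrite /G => /negPf->.
- pose g (q : I * J) := if i == q.1 then Some q.2 else None.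
  apply: (@has_sum_reindex _ _ _ _ (pair i) g) => [j|[i' j]|q|].
  + by rewrite /g eqxx.
  + by rewrite /g /=; case: eqP => //= ->.
  + by rewrite /g /G; case: eqP.
  + by apply: eq_has_sum (Fr i) => [j|//]; rewrite /G /= eqxx.
Qed.

Lemma has_sum_realC {R : realType} {I : choiceType} (x : I -> R^o) (l : R) :
  has_sum x l -> has_sum (fun i => (x i)%:C : R[i]^o) l%:C.
Proof.
move=> /has_sumP xl; apply/has_sumP => e e0.
have eE : e = (complex.Re e)%:C by rewrite RRe_real// ger0_real// ltW.
have [|A AB] := xl (complex.Re e); first by rewrite -ltcR -eE.
exists A => B /AB; rewrite eE -rmorph_sum -rmorphB /=.
by rewrite normc_def /= expr0n addr0 sqrtr_sqr ltcR.
Qed.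

(** * Bessel families and orthonormal bases *)

Section InnerProduct.
Context {R : realType} {V : hilbertType R}.
Local Notation C := R[i].
Implicit Types (u v w : V) (c : C).

Lemma innerC u v : inner u v = ((inner v u)^*)%R.
Proof. by rewrite hermC expr0 mul1r. Qed.

Lemma innerDl u v w : inner (u + v) w = inner u w + inner v w.
Proof. exact: linearDl. Qed.

Lemma innerDr u v w : inner w (u + v) = inner w u + inner w v.
Proof. exact: linearDr. Qed.

Lemma innerBl u v w : inner (u - v) w = inner u w - inner v w.
Proof. exact: linearBl. Qed.

Lemma innerBr u v w : inner w (u - v) = inner w u - inner w v.
Proof. exact: linearBr. Qed.

Lemma inner_suml I (s : seq I) (x : I -> V) v :
  inner (\sum_(i <- s) x i) v = \sum_(i <- s) inner (x i) v.
Proof. exact: linear_sumlz. Qed.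

Lemma inner_sumr I (s : seq I) (x : I -> V) v :
  inner v (\sum_(i <- s) x i) = \sum_(i <- s) inner v (x i).
Proof. exact: linear_sumr. Qed.

Lemma innerZl c u v : inner (c *: u) v = c * inner u v.
Proof. exact: linearZl_LR. Qed.

Lemma innerZr c u v : inner u (c *: v) = (c^*)%R * inner u v.
Proof. exact: linearZr_LR. Qed.

Lemma inner_eq0 u : (inner u u == 0) = (u == 0).
Proof. by rewrite dnorm_eq0. Qed.

Lemma inner_inj u v : (forall w, inner u w = inner v w) -> u = v.
Proof.
by move=> uv; apply/eqP; rewrite -subr_eq0 -inner_eq0 innerBl uv subrr.
Qed.

Lemma inner_injr u v : (forall w, inner w u = inner w v) -> u = v.
Proof. by move=> uv; apply: inner_inj => w; rewrite innerC uv -innerC. Qed.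

Lemma sqr_norm_innerE u v : `|inner u v| ^+ 2 = inner u v * inner v u.
Proof. by rewrite [inner v u]innerC normCK. Qed.

Lemma has_sum_innerl {I : choiceType} (x : I -> V) (l v : V) :
  has_sum x l -> has_sum (fun i => inner (x i) v : C^o) (inner l v).
Proof.
apply: (@has_sum_map _ _ V C^o (fun u => inner u v : C^o) `|v|) => // [u w|u].
  exact: innerBl.
by rewrite mulrC inner_le.
Qed.

Lemma has_sum_innerr {I : choiceType} (x : I -> V) (l v : V) :
  has_sum x l -> has_sum (fun i => inner v (x i) : C^o) (inner v l).
Proof.
apply: (@has_sum_map _ _ V C^o (fun u => inner v u : C^o) `|v|) => // [u w|u].
  exact: innerBr.
by rewrite inner_le.
Qed.

Arguments has_sum_innerl {I x l} v.
Arguments has_sum_innerr {I x l} v.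

(** An element [w0] of the span within [e] of [v] is orthogonal to [v], whence
    [|v|^2 = |<v, v - w0>| <= |v| e]. *)
Lemma total_orthogonal_eq0 (S : set V) v :
  closure (lspan S) = setT -> (forall s, S s -> inner v s = 0) -> v = 0.
Proof.
move=> ST vS; apply/eqP; rewrite -normr_le0; apply/ler_addgt0Pr => e e0.
have : closure (lspan S) v by rewrite ST.
move=> /(_ (ball v e)) [|w [[s sS ->] /=]]; first exact: nbhsx_ballx.
set w0 := \sum_(x <- s) _; rewrite -ball_normE /= add0r => vw.
have vw0 : inner v w0 = 0.
  rewrite /w0 inner_sumr big_seq big1// => x xs.
  by rewrite innerZr vS ?mulr0//; exact: sS.
have [->|v0] := eqVneq v 0; first by rewrite normr0 ltW.
rewrite -(@ler_pM2l _ `|v|) ?normr_gt0// -expr2.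
have -> : `|v| ^+ 2 = `|inner v (v - w0)|.
  by rewrite innerBr vw0 subr0 sqr_norm_inner ger0_norm// dnorm_ge0.
by rewrite (le_trans (inner_le _ _))// ler_wpM2l// ltW.
Qed.

End InnerProduct.
Arguments has_sum_innerl {R V I x l} v.
Arguments has_sum_innerr {R V I x l} v.

(** * Bounded linear maps commute with unordered sums *)

Section BoundedLinear.
Context {R : realType} {V W : hilbertType R}.
Local Notation C := R[i].

Definition bounded_linear (f : V -> W) (M : C) :=
  [/\ linear f, 0 <= M & forall v, `|f v| <= M * `|v|].

Lemma bounded_linear_sum {I : choiceType} (f : V -> W) (M : C) (x : I -> V) l :
  bounded_linear f M -> has_sum x l -> has_sum (f \o x) (f l).
Proof.
move=> [lf M0 fM]; apply: has_sum_map M0 fM => u v.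
by have := lf (-1) v u; rewrite !scaleN1r !(addrC (- _)).
Qed.

End BoundedLinear.

Section Bop.
Context {R : realType} {V : hilbertType R}.
Local Notation C := R[i].
Implicit Types (a b : bop V).

Lemma bop_bounded a : exists M : C, bounded_linear a M.
Proof. by have /asboolP[la [M M0 aM]] := bop_funP a; exists M; split. Qed.

Lemma bop_linear a : linear a.
Proof. by have [M []] := bop_bounded a. Qed.

Lemma bopD a : {morph a : u v / u + v}.
Proof. by move=> u v; have := bop_linear a 1 u v; rewrite !scale1r. Qed.

Lemma bop0 a : a 0 = 0.
Proof. by apply: (@addrI _ (a 0)); rewrite -bopD !addr0. Qed.

Lemma bopZ a (c : C) v : a (c *: v) = c *: a v.
Proof. by have := bop_linear a c v 0; rewrite bop0 !addr0. Qed.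

Lemma bop_sum {I : choiceType} a (x : I -> V) l :
  has_sum x l -> has_sum (fun i => a (x i)) (a l).
Proof. by have [M aM] := bop_bounded a; exact: bounded_linear_sum aM. Qed.

Arguments bop_sum {I} a {x l}.

Lemma bop_eq a b : (forall v, a v = b v) -> a = b.
Proof. by move=> ab; apply: val_inj; apply/funext. Qed.

End Bop.
Arguments bop_sum {R V I} a {x l}.

(** * Bessel families, strong sums of rank-one operators, Parseval *)

Section BesselFamilies.
Context {R : realType} {V : hilbertType R}.
Local Notation C := R[i].

(** The upper frame bound, with [c] positive so that it can be inverted. It makes the sum of the
    [|z_i><z_i|] converge strongly to a bounded operator. *)
Definition bessel {I : choiceType} (z : I -> V) (c : C) :=
  0 < c /\ forall (A : {fset I}) v, \sum_(i <- A) `|inner v (z i)| ^+ 2 <= c * `|v| ^+ 2.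

Context {I : choiceType}.
Implicit Types (z : I -> V) (t : I -> C) (A : {fset I}).

(** The dual form of the Bessel bound, for linear combinations of the [z i] instead of
    coefficients. *)
Lemma bessel_sum_le z c t A : bessel z c ->
  `|\sum_(i <- A) t i *: z i| ^+ 2 <= c * \sum_(i <- A) `|t i| ^+ 2.
Proof.
move=> [c0 zc]; set w := \sum_(i <- A) _.
have wE : `|w| ^+ 2 = \sum_(i <- A) t i * inner (z i) w.
  rewrite sqr_norm_inner {1}/w inner_suml; apply: eq_bigr => i _.
  by rewrite innerZl.
(* AM-GM: [2 |t i| |<z i, w>| <= c |t i|^2 + |<z i, w>|^2 / c] *)
have : 2 * `|w| ^+ 2 <= \sum_(i <- A) (c * `|t i| ^+ 2 + c^-1 * `|inner w (z i)| ^+ 2).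
  rewrite -(ger0_norm (exprn_ge0 2 (normr_ge0 w))) {1}wE.
  rewrite (le_trans (ler_wpM2l _ (ler_norm_sum _ _ _)))// mulr_sumr.
  apply: ler_sum => i _; rewrite normrM [inner (z i) w]innerC norm_conjC.
  set x := `|t i|; set y := `|inner w (z i)|.
  rewrite -subr_ge0.
  have -> : c * x ^+ 2 + c^-1 * y ^+ 2 - 2 * (x * y) = c^-1 * (c * x - y) ^+ 2.
    by field; rewrite gt_eqF.
  apply: mulr_ge0; first by rewrite invr_ge0 ltW.
  have cr : c \is Num.real by rewrite gtr0_real.
  by apply: real_exprn_even_ge0 => //; rewrite realB ?realM ?normr_real.
rewrite big_split/= -!mulr_sumr => le2w.
(* The Bessel inequality bounds the second sum by one of the two copies of [|w|^2], which then
   cancels. *)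
have lew : c^-1 * \sum_(i <- A) `|inner w (z i)| ^+ 2 <= `|w| ^+ 2.
  by rewrite ler_pdivrMl.
rewrite -(lerD2r (`|w| ^+ 2)) -mulr2n -[_ *+ 2]mulr_natl.
by rewrite (le_trans le2w)// lerD2l.
Qed.

(** The norm of a tail is controlled by the tail of the sum of the [|t i|^2], so the partial sums
    are Cauchy in the complete space [V]. *)
Lemma bessel_has_sum z c t (N : C) : bessel z c ->
  (forall A : {fset I}, \sum_(i <- A) `|t i| ^+ 2 <= N) ->
  exists2 l, has_sum (fun i => t i *: z i) l & `|l| ^+ 2 <= c * N.
Proof.
move=> zc tN; have c0 := zc.1.
have t0 i : 0 <= `|t i| ^+ 2 by rewrite exprn_ge0.
have N0 : 0 <= N by rewrite (le_trans _ (tN fset0))// sumr_ge0.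
have [s ts] := has_sum_bounded t0 tN.
have [l tl] : exists l, has_sum (fun i => t i *: z i) l.
  apply/cvg_ex/cauchy_cvgP; apply: cauchy_exP => e e0.
  have [|A AB] := (has_sumP _ _).1 ts (e ^+ 2 / c); first by rewrite divr_gt0// exprn_gt0.
  exists (\sum_(i <- A) t i *: z i), A => // B /= AleB.
  rewrite -ball_normE /= distrC partial_sumE.
  rewrite (big_fsetS _ AleB) addrC addKr.
  rewrite -(@ltr_pXn2r _ 2) ?nnegrE ?(ltW e0)//.
  rewrite (le_lt_trans (bessel_sum_le _ _ zc))// -ltr_pdivlMl// mulrC.
  apply: le_lt_trans (AB _ (fsubset_refl A)).
  have := has_sum_sup B t0 ts; rewrite (big_fsetS _ AleB) => sB.
  by rewrite ger0_norm ?subr_ge0 ?(has_sum_sup _ t0 ts)// lerBrDl.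
exists l => //.
rewrite -[_ * _]sqrtCK lerXn2r ?nnegrE ?sqrtC_ge0 ?mulr_ge0 ?(ltW c0)//.
apply: (norm_has_sum_le _ tl) => A.
rewrite -(@ler_pXn2r _ 2) ?nnegrE ?sqrtC_ge0 ?mulr_ge0 ?(ltW c0)// sqrtCK.
by rewrite (le_trans (bessel_sum_le _ _ zc))// ler_wpM2l ?(ltW c0).
Qed.

(** The Bessel bound enters twice: it makes the coefficients [<v, z_i>] square summable, and it
    bounds the vector built from them. The resulting operator is bounded by [c]. *)
Lemma bessel_op z c : bessel z c ->
  exists b : bop V, strong_sum (fun i => rank1 (z i)) b.
Proof.
move=> zc; have c0 := zc.1.
have bE v : exists2 l, has_sum (fun i => inner v (z i) *: z i) l &
    `|l| ^+ 2 <= c * (c * `|v| ^+ 2).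
  by apply: bessel_has_sum => // A; exact: zc.2.
pose b v := xget 0 (has_sum (fun i => inner v (z i) *: z i)).
have bP v : has_sum (fun i => inner v (z i) *: z i) (b v).
  by have [l vl _] := bE v; apply: (xgetPex 0 (P := has_sum _)); exists l.
have bb : (b : V -> V) \in bounded_op.
  apply/asboolP; split=> [a u v|].
    apply: has_sum_unique (bP _) _.
    apply: eq_has_sum (has_sumD (has_sumZ a (bP u)) (bP v)) => // i.
    by rewrite innerDl innerZl scalerDl scalerA.
  exists c => [|v]; first exact: ltW.
  have [l vl lv] := bE v; rewrite (has_sum_unique (bP v) vl).
  rewrite -(@ler_pXn2r _ 2) ?nnegrE ?mulr_ge0 ?(ltW c0)//.
  by rewrite exprMn (expr2 c) -mulrA.
by exists (Bop bb).
Qed.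

Lemma inner_strong_sum u v z (b : bop V) :
  strong_sum (fun i => rank1 (z i)) b ->
  has_sum (fun i => inner u (z i) * inner (z i) v : C^o) (inner (b u) v).
Proof.
move=> bz; apply: eq_has_sum (has_sum_innerl v (bz u)) => // i /=.
exact: innerZl.
Qed.

Arguments inner_strong_sum u v {z b}.

Definition orthonormal_family (e : I -> V) :=
  forall i j, inner (e i) (e j) = (i == j)%:R.

Lemma orthonormal_bessel e : orthonormal_family e -> bessel e 1.
Proof.
move=> eo; split=> // A v; rewrite mul1r.
pose w := \sum_(i <- A) inner v (e i) *: e i.
have we i : i \in A -> inner w (e i) = inner v (e i).
  move=> iA; rewrite inner_suml (big_fsetD1 i)//= innerZl eo eqxx mulr1.
  rewrite big_seq big1 ?addr0// => j; rewrite !inE => /andP[ji _].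
  by rewrite innerZl eo (negPf ji) mulr0.
have sE : inner v w = \sum_(i <- A) `|inner v (e i)| ^+ 2.
  by rewrite inner_sumr; apply: eq_bigr => i _; rewrite innerZr mulrC normCK.
have ww : inner w w = inner v w.
  rewrite [LHS]inner_sumr [RHS]inner_sumr big_seq [RHS]big_seq.
  by apply: eq_bigr => i iA; rewrite !innerZr we.
have wv : inner w v = inner v w by rewrite innerC -ww -innerC.
have : 0 <= inner (v - w) (v - w) by exact: dnorm_ge0.
by rewrite innerBl !innerBr ww wv subrr subr0 subr_ge0 -sE sqr_norm_inner.
Qed.

(** The sum [s] of the [|e_i><e_i|] satisfies [<s v, e_j> = <v, e_j>] for all [j], so [s v - v] is
    orthogonal to the family and vanishes. *)
Lemma orthonormal_expansion e v : orthonormal_family e ->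
  (forall w, (forall i, inner w (e i) = 0) -> w = 0) ->
  has_sum (fun i => inner v (e i) *: e i) v.
Proof.
move=> eo e0; have [s s_e] := bessel_op (orthonormal_bessel eo).
suff sv : s v = v by rewrite -[X in has_sum _ X]sv; exact: s_e.
apply/eqP; rewrite -subr_eq0; apply/eqP/e0 => j.
rewrite innerBl; apply/eqP; rewrite subr_eq0; apply/eqP.
apply: has_sum_unique (inner_strong_sum v (e j) s_e) _.
have -> : inner v (e j) = inner v (e j) * inner (e j) (e j).
  by rewrite eo eqxx mulr1.
by apply: has_sum_single => i ij; rewrite eo (negPf ij) mulr0.
Qed.

Lemma orthonormal_basisP e : orthonormal_family e ->
  (forall w, (forall i, inner w (e i) = 0) -> w = 0) -> orthonormal_basis e.
Proof.
move=> eo e0; split=> //; apply/seteqP; split=> // v _.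
have /has_sumP ve := orthonormal_expansion (v := v) eo e0.
move=> B /nbhs_ballP[d d0 dB]; have [A /(_ A (fsubset_refl A)) vA] := ve d d0.
exists (\sum_(i <- A) inner v (e i) *: e i); split.
  exists [seq (inner v (e i), e i) | i <- A]; last by rewrite big_map.
  by move=> _ /mapP[i _ ->]; exists i.
by apply: dB; rewrite -ball_normE.
Qed.

Section Basis.
Context (e : I -> V) (eb : orthonormal_basis e).

Lemma basis_orthonormal : orthonormal_family e. Proof. exact: eb.1. Qed.

Lemma basis_eq0 w : (forall i, inner w (e i) = 0) -> w = 0.
Proof. by move=> we; apply: total_orthogonal_eq0 eb.2 _ => _ [i _ <-]. Qed.

Lemma basis_expansion v : has_sum (fun i => inner v (e i) *: e i) v.
Proof. exact: orthonormal_expansion basis_orthonormal basis_eq0. Qed.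

Arguments basis_expansion v : clear implicits.

Lemma parseval_inner u v :
  has_sum (fun i => inner u (e i) * inner (e i) v : C^o) (inner u v).
Proof.
apply: eq_has_sum (has_sum_innerl v (basis_expansion u)) => // i.
exact: innerZl.
Qed.

Arguments parseval_inner u v : clear implicits.

Lemma parseval v : has_sum (fun i => `|inner v (e i)| ^+ 2 : C^o) (`|v| ^+ 2).
Proof.
apply: eq_has_sum (parseval_inner v v) => [i|]; last by rewrite sqr_norm_inner.
by rewrite sqr_norm_innerE.
Qed.

End Basis.

End BesselFamilies.
Arguments basis_expansion {R V I e} eb v.
Arguments parseval_inner {R V I e} eb u v.
Arguments parseval {R V I e} eb v.
Arguments inner_strong_sum {R V I} u v {z b}.

(** * Adjoints, tensor products and partial traces *)

Section Adjoint.
Context {R : realType} {V W : hilbertType R} {I : choiceType} {e : I -> V}.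
Local Notation C := R[i].

(** The adjoint is defined by its coordinates: [g w = sum_i <w, f e_i> e_i]. *)
Lemma bounded_linear_adjoint (f : V -> W) (M : C) :
  orthonormal_basis e -> bounded_linear f M ->
  exists2 g : W -> V, bounded_linear g M &
    forall u w, inner (f u) w = inner u (g w).
Proof.
move=> eb [lf M0 fM].
have eB := orthonormal_bessel (basis_orthonormal eb).
have [fD fZ] : {morph f : u v / u + v} /\ forall c, {morph f : u / c *: u >-> c *: u}.
  have fD : {morph f : u v / u + v}.
    by move=> u v; have := lf 1 u v; rewrite !scale1r.
  split=> // c u; have f0 : f 0 = 0 by apply: (@addrI _ (f 0)); rewrite -fD !addr0.
  by have := lf c u 0; rewrite f0 !addr0.
have f0 : f 0 = 0 by have := fZ 0 0; rewrite !scale0r.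
(* With [a] this sum and [v] the matching combination of the [e_i], [<f v, w> = a] and [|v|^2 <= a],
   so [a^2 <= M^2 a |w|^2]. *)
have gN w (A : {fset I}) : \sum_(i <- A) `|inner w (f (e i))| ^+ 2 <= M ^+ 2 * `|w| ^+ 2.
  set a := \sum_(i <- A) _; pose v := \sum_(i <- A) inner w (f (e i)) *: e i.
  have a0 : 0 <= a by rewrite sumr_ge0// => i _; rewrite exprn_ge0.
  have va : `|v| ^+ 2 <= a by rewrite (le_trans (bessel_sum_le _ _ eB))// mul1r.
  have fvw : inner (f v) w = a.
    rewrite /v (big_morph f fD f0) inner_suml; apply: eq_bigr => i _.
    by rewrite fZ innerZl sqr_norm_innerE.
  have [->|a1] := eqVneq a 0; first by rewrite mulr_ge0// exprn_ge0.
  have a2 : 0 < a by rewrite lt_def a1.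
  rewrite -(ler_pM2l a2).
  have -> : a * a = `|inner (f v) w| ^+ 2 by rewrite fvw ger0_norm.
  apply: (@le_trans _ _ ((M * `|v| * `|w|) ^+ 2)).
    rewrite lerXn2r ?nnegrE ?mulr_ge0// (le_trans (inner_le _ _))//.
    by rewrite ler_wpM2r.
  rewrite !exprMn [leRHS]mulrA [a * _]mulrC ler_wpM2r ?exprn_ge0//.
  by rewrite ler_wpM2l ?exprn_ge0.
have gE w : exists l, has_sum (fun i => inner w (f (e i)) *: e i) l.
  by have [l wl _] := bessel_has_sum eB (gN w); exists l.
pose g w := xget 0 (has_sum (fun i => inner w (f (e i)) *: e i)).
have gP w : has_sum (fun i => inner w (f (e i)) *: e i) (g w).
  exact: (xgetPex 0 (P := has_sum _)).
have fg u w : inner (f u) w = inner u (g w).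
  apply: has_sum_unique (has_sum_innerr u (gP w)).
  have fu := bounded_linear_sum (And3 lf M0 fM) (basis_expansion eb u).
  apply: eq_has_sum (has_sum_innerl w fu) => // i /=.
  by rewrite fZ innerZl innerZr [inner w _]innerC conjCK mulrC.
exists g => //; split=> // [a u v|w].
  apply: inner_injr => w.
  by rewrite innerDr innerZr -!fg innerDr innerZr.
(* The bound on [g w] comes from [|g w|^2 = <f (g w), w> <= M |g w| |w|]. *)
have [->|gw0] := eqVneq (g w) 0; first by rewrite normr0 mulr_ge0.
have gw1 : 0 < `|g w| by rewrite normr_gt0.
rewrite -(ler_pM2l gw1) -expr2 sqr_norm_inner -fg.
rewrite (le_trans (real_ler_norm _))//.
  by rewrite fg ger0_real// dnorm_ge0.
rewrite (le_trans (inner_le _ _))// mulrA ler_wpM2r//.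
by rewrite mulrC.
Qed.

End Adjoint.

Section OperatorAdjoint.
Context {R : realType} {V : hilbertType R} {I : choiceType} {e : I -> V}.
Context (eb : orthonormal_basis e).
Implicit Types (a b : bop V).

Lemma adjointP a : is_adjoint a (adjoint a).
Proof.
apply: (xgetPex 0 (P := is_adjoint a)).
have [M aM] := bop_bounded a.
have [g [lg M0 gM] ag] := bounded_linear_adjoint eb aM.
have gb : g \in bounded_op by apply/asboolP; split=> //; exists M.
by exists (Bop gb).
Qed.

Lemma inner_adjointl a u v : inner (adjoint a u) v = inner u (a v).
Proof. by rewrite innerC -adjointP -innerC. Qed.

Lemma trace_eq a (t : R[i]) : is_trace a t -> trace a = t.
Proof.
move=> at_; apply: has_sum_unique (at_ _ _ eb).
by apply: (xgetPex 0 (P := is_trace a)); [exists t|exact: eb].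
Qed.

End OperatorAdjoint.

(** * Product bases, operators on tensor products, and the emission step *)

Section Tensor.
Context {R : realType} {H1 H2 K : hilbertType R} (T : htensor H1 H2 K).
Local Notation C := R[i].

Lemma norm_tens u v : `|T u v| = `|u| * `|v|.
Proof.
apply/eqP; rewrite -(@eqrXn2 _ 2) ?mulr_ge0//.
by rewrite exprMn !sqr_norm_inner inner_tens.
Qed.

Lemma tens_boundedr u : bounded_linear (T u) `|u|.
Proof.
split=> // [a v w|v]; last by rewrite norm_tens.
exact: linearPr.
Qed.

Lemma tens_boundedl v : bounded_linear (T^~ v) `|v|.
Proof.
split=> // [a u w|u]; last by rewrite norm_tens mulrC.
exact: linearPl.
Qed.

Lemma tensZl c u v : T (c *: u) v = c *: T u v.
Proof. exact: linearZl_LR. Qed.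

Lemma tensZr c u v : T u (c *: v) = c *: T u v.
Proof. exact: linearZr_LR. Qed.

Context {I J : choiceType} {e1 : I -> H1} {e2 : J -> H2}.
Context (e1b : orthonormal_basis e1) (e2b : orthonormal_basis e2).

Lemma tens_expansionr u v :
  has_sum (fun j => inner v (e2 j) *: T u (e2 j)) (T u v).
Proof.
apply: eq_has_sum (bounded_linear_sum (tens_boundedr u) (basis_expansion e2b v)) => // j.
exact: tensZr.
Qed.

Lemma tens_expansionl u v :
  has_sum (fun i => inner u (e1 i) *: T (e1 i) v) (T u v).
Proof.
apply: eq_has_sum (bounded_linear_sum (tens_boundedl v) (basis_expansion e1b u)) => // j.
exact: tensZl.
Qed.

Arguments tens_expansionl u v : clear implicits.
Arguments tens_expansionr u v : clear implicits.

(** A vector orthogonal to all products of basis vectors is orthogonal to every simple tensor, by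
    expanding one argument at a time, and simple tensors are total. *)
Lemma tens_basis : orthonormal_basis (fun ij : I * J => T (e1 ij.1) (e2 ij.2)).
Proof.
apply: orthonormal_basisP => [[i j] [i' j']|w w0] /=.
  by rewrite inner_tens !(basis_orthonormal e1b, basis_orthonormal e2b) -natrM mulnb.
apply: total_orthogonal_eq0 (tens_total T) _ => _ [u [v ->]].
have w1 u' j : inner w (T u' (e2 j)) = 0.
  apply: has_sum_unique (has_sum_innerr w (tens_expansionl u' (e2 j))) _.
  apply: eq_has_sum has_sum0 => // i.
  by rewrite innerZr (w0 (i, j)) mulr0.
apply: has_sum_unique (has_sum_innerr w (tens_expansionr u v)) _.
by apply: eq_has_sum has_sum0 => // i; rewrite innerZr w1 mulr0.
Qed.

(** [x] itself shows that the choice in [optens] does not fall back on 0, and a bounded operator is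
    determined by its values on the product basis. *)
Lemma optens_eq (a : bop H1) (b : bop H2) (x : bop K) :
  (forall u v, x (T u v) = T (a u) (b v)) -> optens T a b = x.
Proof.
move=> xP; set y := optens T a b.
have yP u v : y (T u v) = T (a u) (b v).
  move: u v; pose P := [set x : bop K | forall u v, x (T u v) = T (a u) (b v)].
  apply: (xgetPex 0 (P := P)).
  by exists x.
apply: bop_eq => w.
apply: has_sum_unique (bop_sum y (basis_expansion tens_basis w)) _.
apply: eq_has_sum (bop_sum x (basis_expansion tens_basis w)) => // ij.
by rewrite !bopZ xP yP.
Qed.

Lemma ptrace2_eq (x : bop K) t : is_ptrace2 T x t -> ptrace2 T x = t.
Proof.
move=> xt; apply: bop_eq => u; apply: inner_inj => v.
apply: has_sum_unique (xt _ _ e2b u v).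
by apply: (xgetPex 0 (P := is_ptrace2 T x)); [exists t|exact: e2b].
Qed.

Lemma optens_rank1 x y : optens T (rank1 x) (rank1 y) = rank1 (T x y).
Proof.
apply: optens_eq => u v /=.
by rewrite inner_tens tensZl tensZr scalerA.
Qed.

Lemma optens_rank1l {D : choiceType} x (z : D -> H2) (b : bop H2) :
  strong_sum (fun k => rank1 (z k)) b ->
  strong_sum (fun k => rank1 (T x (z k))) (optens T (rank1 x) b).
Proof.
move=> bz; have [L [lL M0 LM] LP] := bounded_linear_adjoint e2b (tens_boundedr x).
have [N [lb N0 bN]] := bop_bounded b.
have [lT _ TM] := tens_boundedr x.
(* [L] is the adjoint of tensoring with [x], and [L (T u v) = <u, x> v]; hence [X] agrees with the
   tensor product of [|x><x|] and [b] on simple tensors. *)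
pose X w := T x (b (L w)).
have Xb : X \in bounded_op.
  apply/asboolP; split=> [a u v|]; first by rewrite /X lL lb lT.
  exists (`|x| * (N * `|x|)) => [|v]; first by rewrite !mulr_ge0.
  rewrite /X (le_trans (TM _))// -!mulrA ler_wpM2l// (le_trans (bN _))//.
  by rewrite ler_wpM2l.
have -> : optens T (rank1 x) b = Bop Xb.
  apply: optens_eq => u v /=; rewrite /X tensZl -tensZr -bopZ; congr (T x (b _)).
  apply: inner_injr => w.
  by rewrite -LP inner_tens innerZr [inner u x]innerC conjCK.
move=> w /=; have bLw := bounded_linear_sum (tens_boundedr x) (bz (L w)).
apply: eq_has_sum bLw => // k /=.
by rewrite tensZr [inner (L w) _]innerC -LP -innerC.
Qed.

Lemma inner_conj_optens (k x : bop K) w w' :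
  inner ((adjoint k * x * k) w) w' = inner (x (k w)) (k w').
Proof. exact: (inner_adjointl tens_basis). Qed.

Context {D : choiceType}.

(** The strong sum passes through the inner product, and orthonormality of the product basis keeps
    only the term at [ij]. *)
Lemma diag_inner (kappa : I * J -> C) (k : bop K) w ij :
  strong_sum (fun ij => kappa ij *: optens T (rank1 (e1 ij.1)) (rank1 (e2 ij.2))) k ->
  inner (k w) (T (e1 ij.1) (e2 ij.2)) = kappa ij * inner w (T (e1 ij.1) (e2 ij.2)).
Proof.
move=> kS.
pose E ij' := T (e1 ij'.1) (e2 ij'.2); rewrite -/(E ij).
have EE : orthonormal_family E := basis_orthonormal tens_basis.
apply: has_sum_unique (has_sum_innerl (E ij) (kS w)) _.
have sE ij' :
    inner ((kappa ij' *: optens T (rank1 (e1 ij'.1)) (rank1 (e2 ij'.2))) w) (E ij)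
    = kappa ij' * inner w (E ij') * (ij' == ij)%:R.
  rewrite optens_rank1 -EE /= -mulrA -!innerZl.
  by [].
pose x ij' : C^o := kappa ij' * inner w (E ij') * (ij' == ij)%:R.
have xs : has_sum x (x ij).
  by apply: has_sum_single => ij' /negPf ne; rewrite /x ne mulr0.
by apply: eq_has_sum xs => [ij'|]; rewrite /x ?eqxx ?mulr1 -?sE.
Qed.

Arguments diag_inner {kappa k} w ij.

(** In any basis [f] the term at [f i'] is [|kappa i j|^2 <u, e1 i> <e1 i, v> |<e2 j, f i'>|^2], and
    Parseval sums the last factor to 1. The coefficient is kept inside the vector, so that the
    result again has the form [rank1 x]. *)
Lemma transition_rank1 (kappa : I -> J -> C) (k : bop K) i j :
  strong_sum (fun ij =>
    kappa ij.1 ij.2 *: optens T (rank1 (e1 ij.1)) (rank1 (e2 ij.2))) k ->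
  transition T k (optens T (rank1 (e1 i)) (rank1 (e2 j))) = rank1 (kappa i j *: e1 i).
Proof.
move=> kS; apply: ptrace2_eq => I' f fb u v.
have kE w : inner (k w) (T (e1 i) (e2 j)) = kappa i j * inner w (T (e1 i) (e2 j)).
  exact: (diag_inner w (i, j) kS).
have := has_sumZ (kappa i j * (kappa i j)^*%R * inner u (e1 i) * inner (e1 i) v)
  (parseval fb (e2 j)).
apply: eq_has_sum => [i'|].
  rewrite inner_conj_optens optens_rank1 /= innerZl kE [inner _ (k _)]innerC kE.
  rewrite !inner_tens !rmorphM /=.
  rewrite -[((inner v _)^*)%R]innerC -[((inner (f i') _)^*)%R]innerC.
  rewrite sqr_norm_innerE /GRing.scale /=; ring.
rewrite sqr_norm_inner (basis_orthonormal e2b) eqxx /GRing.scale /= mulr1.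
by rewrite !(innerZl, innerZr) ; ring.
Qed.

End Tensor.
Arguments tens_expansionl {R H1 H2 K} T {I e1} e1b u v.
Arguments tens_expansionr {R H1 H2 K} T {J e2} e2b u v.

(** * One step of the hidden chain *)

Section Polarization.
Context {R : realType} {U : lmodType R[i]}.
Local Notation C := R[i].

(** Stated on a bare vector space, since it is applied both to forms on vectors and to forms on
    operators. *)
Definition sesquilinear_form (B : U -> U -> C) :=
  (forall v, scalar (B^~ v)) /\
  (forall u c v w, B u (c *: v + w) = (c^*)%R * B u v + B u w).

(** The imaginary part carries a plus sign because the form is linear in its first argument. *)
Lemma polarization B u v : sesquilinear_form B ->
  B u v = 4^-1 * (B (u + v) (u + v) - B (u - v) (u - v)) +
    4^-1 * 'i%R * (B (u + 'i%R *: v) (u + 'i%R *: v) -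
      B (u - 'i%R *: v) (u - 'i%R *: v)).
Proof.
move=> [Bl Br].
have E c d : (c^*)%R = d -> B (u + c *: v) (u + c *: v) =
    B u u + d * B u v + c * (B v u + d * B v v).
  by move=> <-; rewrite addrC Bl (addrC _ u) (addrC u) !Br; ring.
have i2 : 'i%R * 'i%R = -1 :> C by rewrite -expr2 sqrCi.
have E1 := E 1 1 (rmorph1 _); have Ei := E _ _ (conjCi C).
have EN1 : ((- 1)^*)%R = -1 :> C by rewrite rmorphN rmorph1.
have ENi : ((- 'i)^*)%R = 'i%R :> C by rewrite rmorphN /= conjCi opprK.
have {EN1 ENi} [EN1 ENi] := (E _ _ EN1, E _ _ ENi).
rewrite scale1r in E1; rewrite scaleN1r in EN1.
rewrite E1 EN1 -scaleNr Ei ENi.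
by field: i2.
Qed.

(** Tonelli reaches only nonnegative diagonal terms. Polarization is a fixed finite combination of
    these, so it carries both the convergence and the common value over to arbitrary [u] and [v]. *)
Lemma polarized_sums {I J : choiceType} (B : I -> U -> U -> C)
    (B' : J -> U -> U -> C) u v :
  (forall i, sesquilinear_form (B i)) -> (forall j, sesquilinear_form (B' j)) ->
  (forall w, exists2 q : C, has_sum (fun i => B i w w : C^o) q &
    has_sum (fun j => B' j w w : C^o) q) ->
  exists2 s : C, has_sum (fun i => B i u v : C^o) s &
    has_sum (fun j => B' j u v : C^o) s.
Proof.
move=> sB sB' BB'.
have [q1 B1 B1'] := BB' (u + v); have [q2 B2 B2'] := BB' (u - v).
have [q3 B3 B3'] := BB' (u + 'i%R *: v); have [q4 B4 B4'] := BB' (u - 'i%R *: v).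
exists (4^-1 * (q1 - q2) + 4^-1 * 'i%R * (q3 - q4)).
  have := has_sumD (has_sumZ 4^-1 (has_sumB B1 B2))
    (has_sumZ (4^-1 * 'i%R) (has_sumB B3 B4)).
  by apply: eq_has_sum => // i; rewrite [RHS](polarization _ _ (sB i)).
have := has_sumD (has_sumZ 4^-1 (has_sumB B1' B2'))
  (has_sumZ (4^-1 * 'i%R) (has_sumB B3' B4')).
by apply: eq_has_sum => // j; rewrite [RHS](polarization _ _ (sB' j)).
Qed.

End Polarization.

(** * The hidden transition applied to a sum of rank-one operators *)

Section Step.
Context {R : realType} {H K : hilbertType R} (T : htensor H H K) {D : choiceType}.
Local Notation C := R[i].
Context {e : D -> H} {p : D -> D -> R} {s : D -> D -> C} {k : bop K}.
Context (eb : orthonormal_basis e) (pS : stochastic p)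
  (s2 : forall i j, s i j ^+ 2 = (p i j)%:C)
  (kS : strong_sum (fun ij : D * D =>
    s ij.1 ij.2 *: optens T (rank1 (e ij.1)) (rank1 (e ij.2))) k).

Lemma sqr_norm_sqrt i j : `|s i j| ^+ 2 = (p i j)%:C.
Proof. by rewrite -normrX s2 ger0_norm// ler0c; exact: pS.1. Qed.

Lemma kraus_inner w i j :
  inner (k w) (T (e i) (e j)) = s i j * inner w (T (e i) (e j)).
Proof. exact: (diag_inner eb eb w (i, j) kS). Qed.
Arguments kraus_inner w i j : clear implicits.

(** The diagonal form of [Tr_2(K_H^* K_H) = 1]. In the product basis [k (T u (e j))] has coordinates
    only at the pairs [(i, j)], of squared modulus [p i j |<u, e i>|^2], and the rows of [p] sum to
    1. *)
Lemma kraus_sqr_norm u :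
  has_sum (fun j => `|k (T u (e j))| ^+ 2 : C^o) (`|u| ^+ 2).
Proof.
pose F (j : D) (q : D * D) : C^o := `|inner (k (T u (e j))) (T (e q.1) (e q.2))| ^+ 2.
pose c (q : D * D) : C^o := (p q.1 q.2)%:C * `|inner u (e q.1)| ^+ 2.
have FE j q : F j q = c q * (j == q.2)%:R.
  rewrite /F kraus_inner inner_tens (basis_orthonormal eb) !normrM !exprMn.
  rewrite sqr_norm_sqrt /c normr_nat.
  by case: eqP => _; rewrite ?expr1n ?expr0n/= ?mulr0// !mulr1.
apply: (@tonelli _ _ _ F _ c).
- by move=> j q; rewrite exprn_ge0.
- by move=> j; exact: (parseval (tens_basis T eb eb)).
- move=> q; have -> : c q = F q.2 q by rewrite FE eqxx mulr1.
  by apply: has_sum_single => j /negPf jq; rewrite FE jq mulr0.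
apply: (tonelli_pair _ _ (parseval eb u)) => [q|i].
  by rewrite mulr_ge0 ?exprn_ge0// ler0c; exact: pS.1.
have := has_sumZ (`|inner u (e i)| ^+ 2) (has_sum_realC (pS.2 i)).
by apply: eq_has_sum => [j|]; rewrite /c /GRing.scale /= ?mulr1 1?mulrC.
Qed.

Arguments kraus_sqr_norm u : clear implicits.

(** Input and output are both strong sums of rank-one operators, so that the step can be iterated
    along the chain. *)
Lemma transition_step (z : D -> H) (b : bop H) x :
  strong_sum (fun i => rank1 (z i)) b ->
  exists (z' : D -> H) (b' : bop H),
  [/\ strong_sum (fun i => rank1 (z' i)) b',
      transition T k (optens T (rank1 x) b) = b' &
      forall i, has_sum (fun j =>
        `|inner (e i) x| ^+ 2 * (p i j)%:C * inner (b (e j)) (e j) : C^o)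
        (inner (b' (e i)) (e i))].
Proof.
move=> bz; have [M [_ M0 bM]] := bop_bounded b.
pose beta j := inner (b (e j)) (e j).
have betaE j : has_sum (fun l => `|inner (e j) (z l)| ^+ 2 : C^o) (beta j).
  apply: eq_has_sum (inner_strong_sum (e j) (e j) bz) => // l.
  by rewrite sqr_norm_innerE.
have beta0 j : 0 <= beta j by apply: has_sum_ge0 (betaE j) => l; rewrite exprn_ge0.
have norm_e j : `|e j| = 1.
  apply/eqP; rewrite -(@eqrXn2 _ 2)// sqr_norm_inner (basis_orthonormal eb).
  by rewrite eqxx expr1n.
(* The uniform bound on the diagonal of [b] is what gives the vectors [z'] a Bessel constant. *)
have betaM j : beta j <= M.
  rewrite -(ger0_norm (beta0 j)) (le_trans (inner_le _ _))// norm_e mulr1.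
  by rewrite (le_trans (bM _))// norm_e mulr1.
have [kN kb] := bop_bounded k.
have [lk kN0 kbN] := kb.
have kT_bl j : bounded_linear (fun u => k (T u (e j))) kN.
  split=> // [a u v|u]; first by have [lT _ _] := tens_boundedl T (e j); rewrite lT lk.
  by rewrite (le_trans (kbN _))// norm_tens norm_e mulr1.
have kT_br u : bounded_linear (fun f => k (T u f)) (kN * `|u|).
  split=> // [a f f'||f]; first by have [lT _ _] := tens_boundedr T u; rewrite lT lk.
    by rewrite mulr_ge0.
  by rewrite (le_trans (kbN _))// norm_tens mulrA.
have [y yP] : exists y : D -> H, forall u j,
    inner u (y j) = inner (k (T u (e j))) (T x (e j)).
  have yj j : exists y, forall u, inner u y = inner (k (T u (e j))) (T x (e j)).
    have [g _ gP] := bounded_linear_adjoint eb (kT_bl j).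
    by exists (g (T x (e j))).
  by exists (fun j => projT1 (cid (yj j))) => u j; case: (cid (yj j)).
have yE u j :
    has_sum (fun i => inner (e i) x * s i j * inner u (e i) : C^o) (inner u (y j)).
  rewrite yP; apply: eq_has_sum (has_sum_innerr _ (tens_expansionl T eb x (e j))) => // i.
  rewrite innerZr kraus_inner inner_tens (basis_orthonormal eb) eqxx mulr1 mulrA.
  by rewrite -innerC.
(* [k] is diagonal in the second factor too, so pairing with [T x (e j)] sees only the component of
   [f] along [e j]. *)
have kTf u f j : inner (k (T u f)) (T x (e j)) = inner f (e j) * inner u (y j).
  apply: has_sum_unique (has_sum_innerr _ (tens_expansionl T eb x (e j))) _.
  apply: eq_has_sum (has_sumZ (inner f (e j)) (yE u j)) => // i.
  rewrite innerZr kraus_inner inner_tens -innerC /GRing.scale /=; ring.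
have y_diag i j : inner (e i) (y j) = inner (e i) x * s i j.
  apply: has_sum_unique (yE _ _) _.
  pose F (l : D) : C^o := inner (e l) x * s l j * inner (e i) (e l).
  have -> : inner (e i) x * s i j = F i by rewrite /F (basis_orthonormal eb) eqxx mulr1.
  apply: has_sum_single => l li.
  by rewrite /F (basis_orthonormal eb) eq_sym (negPf li) mulr0.
(* Cauchy-Schwarz bounds each term by [|x|^2 |k (T u (e j))|^2], and [kraus_sqr_norm] sums these. *)
have y_bessel u (A : {fset D}) :
    \sum_(j <- A) `|inner u (y j)| ^+ 2 <= `|x| ^+ 2 * `|u| ^+ 2.
  apply: (@le_trans _ _ (\sum_(j <- A) `|x| ^+ 2 * `|k (T u (e j))| ^+ 2)).
    apply: ler_sum => j _; rewrite yP -exprMn lerXn2r ?nnegrE ?mulr_ge0//.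
    by rewrite (le_trans (inner_le _ _))// norm_tens norm_e mulr1 mulrC.
  rewrite -mulr_sumr ler_wpM2l ?exprn_ge0//.
  by apply: has_sum_sup (kraus_sqr_norm u) => j; rewrite exprn_ge0.
(* The root is real because [beta j] is nonnegative, so [|z' j><z' j| = beta j |y j><y j|]. *)
pose z' j := sqrtC (beta j) *: y j.
have z'E u v j :
    inner u (z' j) * inner (z' j) v = beta j * (inner u (y j) * inner (y j) v).
  rewrite innerZl innerZr conj_Creal ?ger0_real ?sqrtC_ge0//.
  by rewrite mulrACA -expr2 sqrtCK.
(* The added 1 keeps the constant positive when [M] or [x] is zero. *)
have z'b : bessel z' (M * `|x| ^+ 2 + 1).
  split=> [|A u]; first by rewrite ltr_wpDl// mulr_ge0 ?exprn_ge0.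
  apply: (@le_trans _ _ (M * \sum_(j <- A) `|inner u (y j)| ^+ 2)).
    rewrite mulr_sumr; apply: ler_sum => j _.
    by rewrite [leLHS]sqr_norm_innerE z'E -sqr_norm_innerE ler_wpM2r ?exprn_ge0.
  rewrite (le_trans (ler_wpM2l M0 (y_bessel _ _)))// mulrA ler_wpM2r ?exprn_ge0//.
  by rewrite lerDl.
have [b' b'z'] := bessel_op z'b.
have b'E u v :
    has_sum (fun j => beta j * (inner u (y j) * inner (y j) v) : C^o)
      (inner (b' u) v).
  by apply: eq_has_sum (inner_strong_sum u v b'z') => // j; rewrite z'E.
exists z', b'; split=> [//||i]; last first.
  apply: eq_has_sum (b'E (e i) (e i)) => // j.
  by rewrite -sqr_norm_innerE y_diag normrM exprMn sqr_norm_sqrt -/(beta j) mulrC.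
(* The partial trace must have the claimed value in every basis [f], not only in [e]. Below, [B]
   holds the terms in [f] and [B'] those of [b']. *)
apply: (ptrace2_eq eb) => I f fb u v.
pose X := optens T (rank1 x) b.
have XS : strong_sum (fun l => rank1 (T x (z l))) X := optens_rank1l eb eb bz.
pose B i u v := inner (X (k (T u (f i)))) (k (T v (f i))).
pose B' j u v := beta j * (inner u (y j) * inner (y j) v).
have kTl f' a u1 u2 : k (T (a *: u1 + u2) f') = a *: k (T u1 f') + k (T u2 f').
  by have [lT _ _] := tens_boundedl T f'; rewrite lT lk.
have sB i : sesquilinear_form (B i).
  split=> [v' a u1 u2|u' a v1 v2]; rewrite /B kTl.
    by rewrite bop_linear innerDl innerZl.
  by rewrite innerDr innerZr.
have sB' j : sesquilinear_form (B' j).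
  split=> [v' a u1 u2|u' a v1 v2]; rewrite /B'.
    by rewrite innerDl innerZl /GRing.scale /=; ring.
  by rewrite innerDr innerZr; ring.
have BB' w : exists2 q : C, has_sum (fun i => B i w w : C^o) q &
    has_sum (fun j => B' j w w : C^o) q.
  exists (inner (b' w) w); last exact: b'E.
  (* [g l] is the image of [T x (z l)] under the adjoint of [k (T w -)]. The term at [f_i] is
     [sum_l |<f_i, g_l>|^2]; exchanging sums gives [sum_l |g_l|^2], free of [f], and expanding [g_l]
     in [e] and exchanging again gives [sum_j beta_j |<w, y_j>|^2]. *)
  have [G _ GP] := bounded_linear_adjoint eb (kT_br w).
  pose g l := G (T x (z l)).
  have ge l j : inner (e j) (g l) = inner (e j) (z l) * inner w (y j).
    rewrite -GP.
    apply: has_sum_unique (has_sum_innerr _ (tens_expansionr T eb x (z l))) _.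
    pose F (j' : D) : C^o :=
      ((inner (z l) (e j'))^*)%R * (inner (e j) (e j') * inner w (y j')).
    have -> : inner (e j) (z l) * inner w (y j) = F j.
      by rewrite /F (basis_orthonormal eb) eqxx mul1r -innerC.
    apply: (@eq_has_sum _ _ _ F _ (F j)) => // [j'|]; first by rewrite innerZr kTf.
    apply: has_sum_single => j' jj'.
    by rewrite /F (basis_orthonormal eb) eq_sym (negPf jj') mul0r mulr0.
  apply: (@tonelli _ _ _ (fun i l => `|inner (f i) (g l)| ^+ 2) _
    (fun l => `|g l| ^+ 2)).
  - by move=> i l; rewrite exprn_ge0.
  - move=> i; pose kw := k (T w (f i)).
    apply: eq_has_sum (inner_strong_sum kw kw XS) => // l.
    by rewrite -sqr_norm_innerE GP.
  - move=> l; apply: eq_has_sum (parseval fb (g l)) => // i.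
    by rewrite [inner (g l) _]innerC norm_conjC.
  apply: (@tonelli _ _ _ (fun l j => `|inner (e j) (g l)| ^+ 2) _ (fun j => B' j w w)).
  - by move=> l j; rewrite exprn_ge0.
  - move=> l; apply: eq_has_sum (parseval eb (g l)) => // j.
    by rewrite [inner (g l) _]innerC norm_conjC.
  - move=> j; apply: eq_has_sum (has_sumZ (`|inner w (y j)| ^+ 2) (betaE j)) => [l|].
      by rewrite ge normrM exprMn mulrC.
    by rewrite /B' -sqr_norm_innerE mulrC.
  exact: b'E.
have [q Bq B'q] := polarized_sums u v sB sB' BB'.
rewrite (has_sum_unique (b'E u v) B'q).
by apply: eq_has_sum Bq => // i; rewrite (inner_conj_optens T eb eb).
Qed.

End Step.

(** * The law of the chain *)

Section InitialState.
Context {R : realType} {H : hilbertType R} {D : choiceType}.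
Local Notation C := R[i].
Context {e : D -> H} {p0 : D -> R} {w0 : bop H}.
Context (eb : orthonormal_basis e)
  (w0S : strong_sum (fun j => (p0 j)%:C *: rank1 (e j)) w0)
  (w0D : density_operator w0).

Lemma inner_state u v :
  has_sum (fun j => (p0 j)%:C * (inner u (e j) * inner (e j) v) : C^o)
    (inner (w0 u) v).
Proof.
apply: eq_has_sum (has_sum_innerl v (@w0S u)) => // j.
by rewrite -!innerZl.
Qed.
Arguments inner_state u v : clear implicits.

Lemma state_diag j : inner (w0 (e j)) (e j) = (p0 j)%:C.
Proof.
apply: has_sum_unique (inner_state (e j) (e j)) _.
pose F (l : D) : C^o := (p0 l)%:C * (inner (e j) (e l) * inner (e l) (e j)).
have -> : (p0 j)%:C = F j by rewrite /F (basis_orthonormal eb) eqxx !mulr1.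
apply: has_sum_single => l /negPf lj.
by rewrite /F !(basis_orthonormal eb) lj mulr0 mulr0.
Qed.

Lemma initial_ge0 j : 0 <= (p0 j)%:C :> C.
Proof. by rewrite -state_diag; exact: w0D.1. Qed.

Lemma has_sum_initial : has_sum (fun j => (p0 j)%:C : C^o) 1.
Proof.
by apply: eq_has_sum (w0D.2 _ _ eb) => // j; rewrite state_diag.
Qed.

(** The trace must agree in every basis [f], while its terms have no sign. So
    [sum_i <w0 u f_i, v f_i>] and [sum_j p0_j <v^* e_j, u^* e_j>] are compared as forms in the
    operators [u] and [v]: they agree for [u = v] by Tonelli, hence at [u = b], [v = 1] by
    polarization. *)
Lemma trace_state (b : bop H) :
  has_sum (fun j => (p0 j)%:C * inner (b (e j)) (e j) : C^o) (trace (w0 * b)).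
Proof.
suff [t bt tb] : exists2 t,
  has_sum (fun j => (p0 j)%:C * inner (b (e j)) (e j) : C^o) t &
  is_trace (w0 * b) t by rewrite (trace_eq eb tb).
have BB' (I : choiceType) (f : I -> H) : orthonormal_basis f ->
  exists2 t : C, has_sum (fun i => inner ((w0 * b) (f i)) (f i) : C^o) t &
    has_sum (fun j => (p0 j)%:C * inner (b (e j)) (e j) : C^o) t.
  move=> fb.
  pose B i (u v : bop H) := inner (w0 (u (f i))) (v (f i)).
  pose B' j (u v : bop H) := (p0 j)%:C * inner (adjoint v (e j)) (adjoint u (e j)).
  have sB i : sesquilinear_form (B i).
    split=> [v a u1 u2|u a v1 v2]; rewrite /B.
      rewrite [X in w0 X](_ : _ = a *: u1 (f i) + u2 (f i))//.
      by rewrite bop_linear innerDl innerZl.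
    by rewrite [X in inner _ X](_ : _ = a *: v1 (f i) + v2 (f i))// innerDr innerZr.
  have sB' j : sesquilinear_form (B' j).
    split=> [v a u1 u2|u a v1 v2]; rewrite /B'.
      rewrite -!(adjointP eb) [X in inner X _](_ : _ =
        a *: u1 (adjoint v (e j)) + u2 (adjoint v (e j)))//.
      by rewrite innerDl innerZl /GRing.scale /=; ring.
    rewrite ![inner (adjoint _ _) (adjoint u _)]innerC -!(adjointP eb).
    rewrite [X in inner X _](_ : _ =
      a *: v1 (adjoint u (e j)) + v2 (adjoint u (e j)))//.
    by rewrite innerDl innerZl rmorphD rmorphM /=; ring.
  have [w|t Bt B't] := polarized_sums b 1 sB sB'.
    have [M [_ M0 wM]] := bop_bounded (adjoint w).
    have B'w j : B' j w w = (p0 j)%:C * `|adjoint w (e j)| ^+ 2.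
      by rewrite /B' sqr_norm_inner.
    (* The diagonal sum is finite since [|w^* e_j| <= M] and the [p0 j] sum to 1. *)
    have [|A|q B'q] := has_sum_bounded (x := fun j => B' j w w) (M := M ^+ 2).
    - by move=> j; rewrite B'w mulr_ge0 ?initial_ge0 ?exprn_ge0.
    - apply: (@le_trans _ _ (M ^+ 2 * \sum_(j <- A) (p0 j)%:C)).
        rewrite mulr_sumr; apply: ler_sum => j _; rewrite B'w mulrC.
        rewrite ler_wpM2r ?initial_ge0// lerXn2r ?nnegrE//.
        rewrite (le_trans (wM _))// -[leRHS]mulr1 ler_wpM2l//.
        rewrite -(@ler_pXn2r _ 2) ?nnegrE// sqr_norm_inner (basis_orthonormal eb).
        by rewrite eqxx expr1n.
      rewrite -[leRHS]mulr1 ler_wpM2l ?exprn_ge0//.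
      by apply: has_sum_sup has_sum_initial => j; exact: initial_ge0.
    exists q => //.
    apply: (@tonelli _ _ _ (fun i j => (p0 j)%:C * `|inner (f i) (adjoint w (e j))| ^+ 2)
      (fun i => B i w w) (fun j => B' j w w)).
    - by move=> i j; rewrite mulr_ge0 ?initial_ge0 ?exprn_ge0.
    - move=> i; apply: eq_has_sum (inner_state (w (f i)) (w (f i))) => // j.
      by rewrite -sqr_norm_innerE (adjointP eb).
    - move=> j; have wj := parseval fb (adjoint w (e j)).
      apply: eq_has_sum (has_sumZ (p0 j)%:C wj) => [i|].
        by rewrite [inner (f i) _]innerC norm_conjC.
      by rewrite B'w.
    - exact: B'q.
  exists t => //; apply: eq_has_sum B't => // j.
  have adj1 v : adjoint (1 : bop H) v = v.
    by apply: inner_inj => u; rewrite (inner_adjointl eb).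
  by rewrite /B' adj1 -(adjointP eb).
(* The basis [e] fixes the value [t]; any other basis shares the sum weighted by [p0]. *)
have [t _ bt] := BB' _ _ eb; exists t => // I f fb.
by have [t' ft' bt'] := BB' _ _ fb; rewrite (has_sum_unique bt bt').
Qed.

End InitialState.

(** * Path weights and the iterated transition *)

Section Chain.
Context {R : realType} {H K : hilbertType R} (T : htensor H H K) {D : choiceType}.
Local Notation C := R[i].
Context {e : D -> H} {p : D -> D -> R} {s : D -> D -> C} {k : bop K}.
Context (eb : orthonormal_basis e) (pS : stochastic p)
  (s2 : forall i j, s i j ^+ 2 = (p i j)%:C)
  (kS : strong_sum (fun ij : D * D =>
    s ij.1 ij.2 *: optens T (rank1 (e ij.1)) (rank1 (e ij.2))) k).

(** With [w] the initial law this is the summand of the theorem. The weight is left arbitrary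
    because the induction on [n] absorbs the first site into it. *)
Definition path_weight (w : D -> C) (x : nat -> H) n (j : {ffun 'I_n.+1 -> D}) : C :=
  w (j ord0) *
  (\prod_(m < n) (p (j (widen_ord (leqnSn n) m)) (j (lift ord0 m)))%:C) *
  \prod_(m < n.+1) `|inner (e (j m)) (x m)| ^+ 2.

Lemma path_weight_ge0 w x n j : (forall i, 0 <= w i) -> 0 <= @path_weight w x n j.
Proof.
move=> w0; rewrite !mulr_ge0//; apply: prodr_ge0 => m _; last exact: exprn_ge0.
by rewrite ler0c; exact: pS.1.
Qed.

Definition path_cons n (q : D * {ffun 'I_n.+1 -> D}) : {ffun 'I_n.+2 -> D} :=
  [ffun m => if unlift ord0 m is Some m' then q.2 m' else q.1].

Definition path_uncons n (j : {ffun 'I_n.+2 -> D}) : D * {ffun 'I_n.+1 -> D} :=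
  (j ord0, [ffun m => j (lift ord0 m)]).

Lemma path_consK n : cancel (@path_cons n) (@path_uncons n).
Proof.
move=> [i j]; rewrite /path_uncons ffunE unlift_none; congr (_, _).
by apply/ffunP => m; rewrite !ffunE liftK.
Qed.

Lemma path_unconsK n : cancel (@path_uncons n) (@path_cons n).
Proof.
move=> j; apply/ffunP => m; rewrite ffunE; case: unliftP => [m'|] -> //=.
by rewrite ffunE.
Qed.

(** The factor of site 0 and the first transition out of it become the initial weight of the
    remaining path. *)
Lemma path_weight_cons w x n i (j : {ffun 'I_n.+1 -> D}) :
  path_weight w x (path_cons (i, j)) =
  path_weight (fun l => w i * `|inner (e i) (x 0%N)| ^+ 2 * (p i l)%:C)
    (fun m => x m.+1) j.
Proof.
have c0 : path_cons (i, j) ord0 = i by rewrite ffunE unlift_none.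
have cS m : path_cons (i, j) (lift ord0 m) = j m by rewrite ffunE liftK.
have widen0 : widen_ord (leqnSn n.+1) ord0 = ord0 by exact: val_inj.
have widenS m :
    widen_ord (leqnSn n.+1) (lift ord0 m) = lift ord0 (widen_ord (leqnSn n) m).
  by exact: val_inj.
have -> : path_weight w x (path_cons (i, j)) = w i *
    ((p i (j ord0))%:C *
     \prod_(m < n) (p (j (widen_ord (leqnSn n) m)) (j (lift ord0 m)))%:C) *
    (`|inner (e i) (x 0%N)| ^+ 2 *
     \prod_(m < n.+1) `|inner (e (j m)) (x m.+1)| ^+ 2).
  rewrite /path_weight c0; congr (_ * _ * _); rewrite big_ord_recl ?widen0 ?cS c0.
    by congr (_ * _); apply: eq_bigr => m _; rewrite widenS !cS.
  by congr (_ * _); apply: eq_bigr => m _; rewrite cS.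
by rewrite /path_weight; ring.
Qed.

Lemma strong_sum1 : strong_sum (fun i => rank1 (e i)) 1.
Proof. exact: basis_expansion. Qed.

(** Induction on [n]; [w] is quantified in the last clause so that the induction hypothesis can be
    used at a new weight for each first site. *)
Lemma nested_chain n (x : nat -> H) : exists (z : D -> H) (b : bop H),
  [/\ strong_sum (fun i => rank1 (z i)) b,
      nested T (transition T k) (mkseq (fun m => rank1 (x m)) n.+1) = b &
      forall (w : D -> C) (S : C), (forall i, 0 <= w i) ->
        has_sum (fun i => w i * inner (b (e i)) (e i) : C^o) S ->
        has_sum (fun j : {ffun 'I_n.+1 -> D} => path_weight w x j : C^o) S].
Proof.
elim: n x => [|n IHn] x.
  (* The nesting ends at 1, which is [sum_i |e i><e i|], so a chain of one site is already one
     transition. *)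
  have [z [b [bz bE bS]]] := transition_step eb pS s2 kS (x 0%N) strong_sum1.
  exists z, b; split=> // w S w0 wS.
  have bx i : inner (b (e i)) (e i) = `|inner (e i) (x 0%N)| ^+ 2.
    apply: has_sum_unique (bS i) _.
    have := has_sumZ (`|inner (e i) (x 0%N)| ^+ 2) (has_sum_realC (pS.2 i)).
    apply: eq_has_sum => [j|]; last by rewrite /GRing.scale /= mulr1.
    by rewrite (basis_orthonormal eb) eqxx mulr1.
  pose f (i : D) : {ffun 'I_1 -> D} := [ffun => i].
  apply: (@has_sum_reindex _ _ _ _ f (fun j => Some (j ord0))) => // [i|j|].
  - by rewrite /f ffunE.
  - apply/ffunP => m; rewrite /f /= ffunE; congr (j _).
    by rewrite [RHS]ord1; exact: val_inj.
  apply: eq_has_sum wS => // i.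
  by rewrite bx /path_weight /= big_ord0 big_ord1 !ffunE mulr1.
have [z1 [b1 [b1z b1E b1S]]] := IHn (fun m => x m.+1).
have [z [b [bz bE bS]]] := transition_step eb pS s2 kS (x 0%N) b1z.
exists z, b; split=> //.
  have -> : mkseq (fun m => rank1 (x m)) n.+2 =
      rank1 (x 0%N) :: mkseq (fun m => rank1 (x m.+1)) n.+1.
    by rewrite /mkseq /= (iotaDl 1 1) -map_comp.
  by rewrite -bE -b1E.
move=> w S w0 wS.
apply: (@has_sum_reindex _ _ _ _ (@path_cons n) (Some \o @path_uncons n)) => // [q|j|].
- by rewrite /= path_consK.
- by rewrite /= path_unconsK.
apply: tonelli_pair wS => [q|i]; first exact: path_weight_ge0.
pose w' l := w i * `|inner (e i) (x 0%N)| ^+ 2 * (p i l)%:C.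
have w'0 l : 0 <= w' l.
  by rewrite !mulr_ge0 ?exprn_ge0// ler0c; exact: pS.1.
(* The diagonal recursion for [b], multiplied by [w i], is the premise that the shorter chain asks
   for at the weight [w']. *)
have w'S : has_sum (fun l => w' l * inner (b1 (e l)) (e l) : C^o)
    (w i * inner (b (e i)) (e i)).
  apply: eq_has_sum (has_sumZ (w i) (bS i)) => // l.
  by rewrite /w' /GRing.scale /= !mulrA.
apply: eq_has_sum (b1S w' _ w'0 w'S) => // j.
by rewrite /= path_weight_cons.
Qed.

Lemma has_sum_chain (p0 : D -> R) (w0 : bop H) n (x : nat -> H) :
  strong_sum (fun j => (p0 j)%:C *: rank1 (e j)) w0 -> density_operator w0 ->
  has_sum (fun j : {ffun 'I_n.+1 -> D} => path_weight (fun i => (p0 i)%:C) x j : C^o)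
    (trace (w0 * nested T (transition T k) (mkseq (fun m => rank1 (x m)) n.+1))).
Proof.
move=> w0S w0D; have [z [b [_ -> bS]]] := nested_chain n x.
apply: bS; first exact: (initial_ge0 eb w0S w0D).
exact: (trace_state eb w0S w0D).
Qed.

End Chain.

(** * Joint probabilities on the diagonal algebra *)

Theorem theorem12 (R : realType)
  (* the Hilbert space, its tensor square, the index set of its bases *)
  (H HH : hilbertType R) (T : htensor H H HH) (D : countType)
  (* the hidden quantum Markov chain *)
  (eH : D -> H) (p0 : D -> R) (w0 : bop H)
  (p : D -> D -> R) (sqrtp : D -> D -> R[i]) (KH : bop HH)
  (AH : algType R[i]) (jH : nat -> bop H -> AH) (PH : {scalar AH})
  (* the emission operators and the (H, O)-process *)
  (eH' eO' : nat -> D -> H) (kO : nat -> D -> D -> R[i]) (KO : nat -> bop HH)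
  (AHO : algType R[i]) (iH iO : nat -> bop H -> AHO) (PHO : {scalar AHO}) :
  orthonormal_basis eH ->
  strong_sum (fun j => (p0 j)%:C *: rank1 (eH j)) w0 ->
  density_operator w0 ->
  nondegenerate_spectrum w0 ->
  stochastic p ->
  (forall i j, sqrtp i j ^+ 2 = (p i j)%:C) ->
  strong_sum (fun ij : D * D =>
    sqrtp ij.1 ij.2 *: optens T (rank1 (eH ij.1)) (rank1 (eH ij.2))) KH ->
  algebraic_tensor_product jH ->
  quantum_markov_chain T jH (fun a => trace (w0 * a)) (transition T KH) PH ->
  (forall n, orthonormal_basis (eH' n)) ->
  (forall n, orthonormal_basis (eO' n)) ->
  (forall n, strong_sum (fun ij : D * D =>
    kO n ij.1 ij.2 *: optens T (rank1 (eH' n ij.1)) (rank1 (eO' n ij.2)))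
    (KO n)) ->
  (forall n, conditional_density_amplitude T (KO n)) ->
  algebraic_tensor_product
    (fun i : nat + nat => match i with inl m => iH m | inr m => iO m end) ->
  quantum_hidden_process T jH PH iH iO (fun n => transition T (KO n)) PHO ->
  forall (n : nat) (h k : 'I_n.+1 -> D),
  exists2 S : R[i],
    has_sum (fun j : {ffun 'I_n.+1 -> D} =>
      (p0 (j ord0))%:C *
      (\prod_(m < n) (p (j (widen_ord (leqnSn n) m)) (j (lift ord0 m)))%:C) *
      \prod_(m < n.+1) `|inner (eH (j m)) (eH' m (h m))| ^+ 2 : R[i]^o) S &
    PHO ((\prod_(m < n.+1) iH m (rank1 (eH' m (h m)))) *
         (\prod_(m < n.+1) iO m (rank1 (eO' m (k m))))) =
    (\prod_(m < n.+1) `|kO m (h m) (k m)| ^+ 2) * S.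
Proof.
move=> eHb w0S w0D _ pS s2 kS _ PHE eH'b eO'b kOS _ [[_ iHOC] _] PHOE n h k.
(* The process laws take families indexed by [nat]; [inord] extends the given ones beyond [n]. *)
pose h' m := h (inord m); pose k' m := k (inord m).
(* The emission amplitude is absorbed into the vector, so that the chain receives [rank1 (x m)]. *)
pose x m := kO m (h' m) (k' m) *: eH' m (h' m).
have emitE m : transition T (KO m)
    (optens T (rank1 (eH' m (h' m))) (rank1 (eO' m (k' m))))
    = rank1 (x m).
  exact: (transition_rank1 (eH'b m) (eO'b m) _ _ (kOS m)).
have PHO_E : PHO ((\prod_(m < n.+1) iH m (rank1 (eH' m (h m)))) *
    (\prod_(m < n.+1) iO m (rank1 (eO' m (k m))))) =
    trace (w0 * nested T (transition T KH) (mkseq (fun m => rank1 (x m)) n.+1)).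
  (* The two products are interleaved site by site, since hidden and observed embeddings commute,
     also at equal sites. *)
  rewrite -PHE -prodrM_comm; last first.
    by move=> i j _ _; exact: (iHOC (inl (val i)) (inr (val j))).
  transitivity (PHO (\prod_(m < n.+1)
      (iH m (rank1 (eH' m (h' m))) * iO m (rank1 (eO' m (k' m)))))).
    by congr (PHO _); apply: eq_bigr => m _; rewrite /h' /k' inord_val.
  rewrite (PHOE n (fun m => rank1 (eH' m (h' m))) (fun m => rank1 (eO' m (k' m)))).
  by congr (PH _); apply: eq_bigr => m _; rewrite emitE.
rewrite PHO_E.
(* The chain is evaluated twice: with the unit vectors [eH'] to get [S], and with the scaled vectors
   [x] to get the joint probability. Path by path the weights differ by the product of the
   [|kO m (h m) (k m)|^2]. *)
have S1 := has_sum_chain (n := n) eHb pS s2 kS (x := fun m => eH' m (h' m)) w0S w0D.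
have S2 := has_sum_chain (n := n) eHb pS s2 kS (x := x) w0S w0D.
set S : R[i] := trace _ in S1; exists S.
  apply: eq_has_sum S1 => [j|//]; rewrite /path_weight; congr (_ * _).
  by apply: eq_bigr => m _; rewrite /h' inord_val.
apply: has_sum_unique S2 _.
apply: eq_has_sum (has_sumZ (\prod_(m < n.+1) `|kO m (h m) (k m)| ^+ 2) S1) => // j.
rewrite /path_weight /GRing.scale /= mulrCA -big_split /=; congr (_ * _).
apply: eq_bigr => m _; rewrite /x /h' /k' inord_val innerZr normrM exprMn.
by rewrite norm_conjC.
Qed.
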